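(* Let $\boldsymbol\mu\in\mathcal S$ be an exponential family bandit model. Let $\alpha\in[1,e/2]$ and let $r:\{1,2,\dots\}\to(0,\infty)$ satisfy $r(t)=O(t^\alpha)$. Using Chernoff's stopping rule $\tau_\delta$ with threshold $\beta(t,\delta)=\log(r(t)/\delta)$, and the sampling rule C-Tracking or D-Tracking, $$\limsup_{\delta\to0}\frac{\mathbb E_{\boldsymbol\mu}[\tau_\delta]}{\log(1/\delta)}\le\alpha\,T^*(\boldsymbol\mu).$$
   Context: Let $K\ge2$, $\mathcal A=\{1,\dots,K\}$. Exponential family: $\Theta\subset\mathbb R$ is an open interval, $\xi$ is a reference measure on $\mathbb R$, $b:\Theta\to\mathbb R$ is convex and twice differentiable, and $\nu_\theta$ is the probability distribution with density $\frac{d\nu_\theta}{d\xi}(x)=\exp(\theta x-b(\theta))$. Its mean is $\dot b(\theta)$, and for each $\mu\in\dot b(\Theta)$ there is a unique distribution $\nu^\mu$ of the family with mean $\mu$. $d(\mu,\mu')=\mathrm{KL}(\nu^\mu,\nu^{\mu'})$. $\mathcal S$ is the set of $\boldsymbol\mu\in\dot b(\Theta)^K$ with a unique maximal coordinate, whose index is $a^*(\boldsymbol\mu)$. Under $\mathbb P_{\boldsymbol\mu}$ (expectation $\mathbb E_{\boldsymbol\mu}$), at each time $t=1,2,\dots$ an arm $A_t\in\mathcal A$ is chosen based on the past and a new independent reward $X_t$ is drawn from $\nu^{\mu_{A_t}}$. $\mathrm{Alt}(\boldsymbol\mu)=\{\boldsymbol\lambda\in\mathcal S:a^*(\boldsymbol\lambda)\neq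 a^*(\boldsymbol\mu)\}$, $\Sigma_K=\{w\in\mathbb R_+^K:\sum_aw_a=1\}$, $$T^*(\boldsymbol\mu)^{-1}=\sup_{w\in\Sigma_K}\inf_{\boldsymbol\lambda\in\mathrm{Alt}(\boldsymbol\mu)}\sum_{a=1}^Kw_ad(\mu_a,\lambda_a),$$ and $w^*(\boldsymbol\mu)\in\Sigma_K$ is the (unique) maximizer $w$ of this supremum. $N_a(t)$ is the number of draws of arm $a$ up to time $t$, $\hat\mu_a(t)=N_a(t)^{-1}\sum_{s\le t}X_s\mathbf 1\{A_s=a\}$, $\hat{\boldsymbol\mu}(t)=(\hat\mu_1(t),\dots,\hat\mu_K(t))$. Whenever $\hat{\boldsymbol\mu}(t)$ is undefined or not in $\mathcal S$, $w^*(\hat{\boldsymbol\mu}(t))$ denotes an arbitrary (measurably chosen) element of $\Sigma_K$. C-Tracking: for $\epsilon\in(0,1/K]$ let $w^\epsilon(\cdot)$ be an $L^\infty$ projection of $w^*(\cdot)$ onto $\Sigma_K^\epsilon=\{w\in[\epsilon,1]^K:\sum_aw_a=1\}$, let $\epsilon_t=(K^2+t)^{-1/2}/2$, and choose $A_{t+1}\in\operatorname{argmax}_{1\le a\le K}\ \sum_{s=0}^tw_a^{\epsilon_s}(\hat{\boldsymbol\mu}(s))-N_a(t)$ for $t\ge0$. D-Tracking: with $U_t=\{a:N_a(t)<\sqrt t-K/2\}$, choose $A_{t+1}\in\operatorname{argmin}_{a\in U_t}N_a(t)$ if $U_t\ne\emptyset$, and $A_{t+1}\in\operatorname{argmax}_{1\le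 a\le K}\ t\,w_a^*(\hat{\boldsymbol\mu}(t))-N_a(t)$ otherwise. Chernoff's stopping rule: let $\underline X^a_{N_a(t)}=(X_s:A_s=a,\ s\le t)$ and, for $\mu\in\dot b(\Theta)$, $p_\mu(z_1,\dots,z_n)=\prod_{k=1}^n\exp\big(\dot b^{-1}(\mu)z_k-b(\dot b^{-1}(\mu))\big)$ (value $1$ for an empty vector). For $a\ne b$, $$Z_{a,b}(t)=\log\frac{\sup_{\mu_a'\ge\mu_b'}p_{\mu_a'}(\underline X^a_{N_a(t)})\,p_{\mu_b'}(\underline X^b_{N_b(t)})}{\sup_{\mu_a'\le\mu_b'}p_{\mu_a'}(\underline X^a_{N_a(t)})\,p_{\mu_b'}(\underline X^b_{N_b(t)})},$$ the suprema being over $\mu_a',\mu_b'\in\dot b(\Theta)$, and $$\tau_\delta=\inf\Big\{t\ge1:\ \max_{a\in\mathcal A}\min_{b\in\mathcal A\setminus\{a\}}Z_{a,b}(t)>\beta(t,\delta)\Big\}.$$ *)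

(* Defs.v *)
From HB Require Import structures.
From mathcomp Require Export all_boot all_order all_algebra.
From mathcomp Require Export all_classical all_reals all_analysis.
Export Order.TTheory GRing.Theory Num.Theory.
Export numFieldNormedType.Exports.

Set Implicit Arguments.
Unset Strict Implicit.
Unset Printing Implicit Defensive.

Local Open Scope classical_set_scope.
Local Open Scope ring_scope.

(* logpart is meaningful on param only; as param is open, derive1 logpart and its
   derivability on param do not depend on the values of logpart elsewhere. *)
Record expFamily (R : realType) := ExpFamily {
  param : set R ;
  refmeas : {measure set (measurableTypeR R) -> \bar R} ;
  logpart : R -> R ;
  param_interval : is_interval param ;
  param_open : open param ;
  logpart_convex : convex_function (E := R^o) param logpart ;
  logpart_derivable : forall x, param x -> derivable logpart x 1 ;
  logpart_derivable2 : forall x, param x -> derivable (derive1 logpart) x 1 ;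
  density_total : forall x, param x ->
    (\int[refmeas]_z (expR (x * z - logpart x))%:E = 1)%E
}.

Section ExponentialFamily.
Context {R : realType}.
Variable E : expFamily R.

Definition density (x z : R) : R := expR (x * z - logpart E x).

Definition mean_dom : set R := derive1 (logpart E) @` param E.

(* The inverse of the derivative of logpart; it is single-valued as soon as
   mean_dom has two points, and arbitrary outside mean_dom. *)
Definition theta_of (m : R) : R :=
  get [set x | param E x /\ derive1 (logpart E) x = m].

Definition nu (m : R) (B : set R) : \bar R :=
  (\int[refmeas E]_(z in B) (density (theta_of m) z)%:E)%E.

(* Kullback-Leibler divergence of two distributions given by their (positive)
   densities with respect to the same reference measure xi. *)
Definition KL (xi : {measure set (measurableTypeR R) -> \bar R})
    (p q : R -> R) : \bar R :=
  (\int[xi]_z (p z * ln (p z / q z))%:E)%E.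

Definition div (m m' : R) : \bar R :=
  KL (refmeas E) (density (theta_of m)) (density (theta_of m')).

Definition likelihood (m : R) (zs : seq R) : R :=
  \prod_(z <- zs) density (theta_of m) z.

End ExponentialFamily.

Section Complexity.
Context {R : realType} {K : nat}.
Variable E : expFamily R.
Implicit Types (mu lam w : 'I_K -> R).

(* Some a if a is the unique maximal coordinate of mu, None if there is none. *)
Definition best_arm mu : option 'I_K :=
  [pick a | [forall b, (b != a) ==> (mu b < mu a)]].

Definition bandits : set ('I_K -> R) :=
  [set mu | (forall a, mean_dom E (mu a)) /\ best_arm mu <> None].

Definition Alt mu : set ('I_K -> R) :=
  [set lam | bandits lam /\ best_arm lam <> best_arm mu].

Definition simplex : set ('I_K -> R) :=
  [set w | (forall a, 0 <= w a) /\ \sum_a w a = 1].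

Definition info mu w : \bar R :=
  ereal_inf [set (\sum_a (w a)%:E * div E (mu a) (lam a))%E | lam in Alt mu].

Definition Tstar_inv mu : \bar R := ereal_sup [set info mu w | w in simplex].

Definition Tstar mu : \bar R := ((Tstar_inv mu)^-1)%E.

Definition wstar mu : 'I_K -> R :=
  get [set w | simplex w /\ info mu w = Tstar_inv mu].

End Complexity.

(* Statistics of one trajectory: A t and X t are the arm and the reward of
   round t, for t >= 1; A 0 and X 0 are never used. *)
Section Trajectory.
Context {R : realType} {K : nat}.
Variable E : expFamily R.
Implicit Types (A : nat -> 'I_K) (X : nat -> R).

Definition draws A (t : nat) (a : 'I_K) : nat :=
  (\sum_(1 <= s < t.+1) (A s == a))%N.

Definition emp_mean A X (t : nat) (a : 'I_K) : R :=
  (draws A t a)%:R^-1 * \sum_(1 <= s < t.+1 | A s == a) X s.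

Definition rewards A X (t : nat) (a : 'I_K) : seq R :=
  [seq X s | s <- iota 1 t & A s == a].

Definition sup_likelihood (C : rel R) (xs ys : seq R) : \bar R :=
  ereal_sup [set (likelihood E m.1 xs * likelihood E m.2 ys)%:E
    | m in [set m : R * R |
             [/\ mean_dom E m.1, mean_dom E m.2 & C m.1 m.2]]].

Definition glr A X (t : nat) (a b : 'I_K) : \bar R :=
  let xa := rewards A X t a in
  let xb := rewards A X t b in
  let Lge := sup_likelihood (fun m m' => m >= m') xa xb in
  let Lle := sup_likelihood (fun m m' => m <= m') xa xb in
  lne (Lge / Lle)%E.

Definition chernoff A X (t : nat) : \bar R :=
  \big[Order.max/-oo%E]_(a < K)
    \big[Order.min/+oo%E]_(b < K | b != a) glr A X t a b.

Definition stopping_time (beta : nat -> R) A X : \bar R :=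
  ereal_inf [set (t%:R)%:E
    | t in [set t : nat | (1 <= t)%N /\ ((beta t)%:E < chernoff A X t)%E]].

End Trajectory.

Section Sampling.
Context {R : realType} {K : nat} {d : measure_display} {T : measurableType d}.
Variable E : expFamily R.
Variables (A : nat -> T -> 'I_K) (X : nat -> T -> R).

(* F t is the information available after round t. It may be larger than the
   sigma-algebra generated by the first t arms and rewards, so that the choice
   of the next arm (ties for instance) may use an independent randomization. *)
Record bandit_model (P : probability T R) (F : nat -> set (set T))
    (mu : 'I_K -> R) : Prop := BanditModel {
  past_sigma_algebra : forall t, sigma_algebra [set: T] (F t) ;
  past_measurable : forall t, F t `<=` measurable ;
  past_nondecreasing : forall s t, (s <= t)%N -> F s `<=` F t ;
  arm_past : forall t a, F t (A t.+1 @^-1` [set a]) ;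
  reward_past : forall t (B : set R), measurable B -> F t.+1 (X t.+1 @^-1` B) ;
  (* given the past and A_(t+1) = a, the reward X_(t+1) has law nu (mu a) *)
  reward_law : forall t a (G : set T) (B : set R), F t G -> measurable B ->
    P (G `&` A t.+1 @^-1` [set a] `&` X t.+1 @^-1` B)
    = (P (G `&` A t.+1 @^-1` [set a]) * nu E (mu a) B)%E
}.

(* W t plays the role of w^*(emp_mean t), extended by an arbitrary measurable
   choice when emp_mean t is undefined or is not in bandits. *)
Record plugin_weights (F : nat -> set (set T)) (W : nat -> T -> 'I_K -> R)
    : Prop := PluginWeights {
  weights_simplex : forall t x, simplex (W t x) ;
  weights_past : forall t a (B : set R), measurable B ->
    F t ((fun x => W t x a) @^-1` B) ;
  weights_wstar : forall t x,
    (forall a, (0 < draws (A^~ x) t a)%N) ->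
    bandits E (emp_mean (A^~ x) (X^~ x) t) ->
    W t x = wstar E (emp_mean (A^~ x) (X^~ x) t)
}.

Definition Linf_dist (v w : 'I_K -> R) : R :=
  \big[Order.max/0]_(a < K) `|v a - w a|.

Definition simplex_ge (eps : R) : set ('I_K -> R) :=
  [set w | (forall a, eps <= w a <= 1) /\ \sum_a w a = 1].

Definition is_Linf_proj (eps : R) (w v : 'I_K -> R) : Prop :=
  simplex_ge eps v /\
  forall u, simplex_ge eps u -> Linf_dist v w <= Linf_dist u w.

Definition eps_seq (t : nat) : R := (Num.sqrt (K ^ 2 + t)%:R)^-1 / 2.

Definition C_tracking (W : nat -> T -> 'I_K -> R) : Prop :=
  exists V : nat -> T -> 'I_K -> R,
    (forall s x, is_Linf_proj (eps_seq s) (W s x) (V s x)) /\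
    forall t x b,
      let score a := \sum_(0 <= s < t.+1) V s x a - (draws (A^~ x) t a)%:R in
      score b <= score (A t.+1 x).

Definition underdrawn (t : nat) (x : T) : {set 'I_K} :=
  [set a | (draws (A^~ x) t a)%:R < Num.sqrt (t%:R : R) - K%:R / 2]%SET.

Definition D_tracking (W : nat -> T -> 'I_K -> R) : Prop :=
  forall t x,
    let U := underdrawn t x in
    let N := draws (A^~ x) t in
    let score a := t%:R * W t x a - (N a)%:R in
    if U != finset.set0 then
      (A t.+1 x \in U) /\ (forall b, b \in U -> (N (A t.+1 x) <= N b)%N)
    else forall b, score b <= score (A t.+1 x).

End Sampling.

(* Main.v *)
From HB Require Import structures.
Require Import Defs.
From mathcomp Require Import measurable_realfun ring lra.

(** Let [T] be the inverse of the characteristic time of mu, that is, the largest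
    value over the simplex of the information of mu, attained at w*. The case
    [T = 0] is trivial. Otherwise it suffices to bound the expected stopping time
    by ln (1/delta) / q + C for each q < T, with C independent of delta: the
    limsup is then at most 1/T, hence at most alpha/T as alpha >= 1. In the
    threshold, ln (r t) grows logarithmically and is negligible with respect to t.

    Geometry. In an exponential family the divergence is the Bregman divergence of
    the log-partition function. Hence the cheapest way to make arm b as good as the
    best arm i is to give both their weighted mean, and the information is the
    minimum over b of the costs [pair_info] so obtained ([info_ge], [info_le]).
    These costs are concave in the weights, homogeneous, continuous, and strictly
    concave up to scaling; compactness of the simplex then gives the existence and
    uniqueness of w* ([maximizer_unique]) and the continuity at mu of the optimal
    weights ([wstar_continuous]). The same costs, with the numbers of draws as
    weights and the empirical means in place of mu, bound the generalized
    likelihood ratios from below ([glr_ge]).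

    Sampling. Both rules draw each arm at least of order sqrt t times
    ([exploration]). If the plug-in weights are close to w* from time L on, then
    the proportions of draws are close to w* from a time proportional to L + 1 on
    ([tracks]), so the statistic exceeds q' t for some q' in (q, T)
    ([chernoff_grows]) and the rule stops as soon as this exceeds the threshold.

    Probability. It remains to bound the last time L at which an empirical mean is
    off by an integrable variable. Shifting the natural parameter of one arm by
    h or - h gives a likelihood ratio [lr] of mean 1 ([lr_integral]), which is at
    least exp (c sqrt t) at each bad time t, because of the forced exploration.
    Therefore the sum over t of (t + 1) exp (- c sqrt t) times these ratios exceeds
    every bad time ([good_times]) and has finite mean
    ([deviation_bound_integral]). *)

Set Implicit Arguments.
Unset Strict Implicit.
Unset Printing Implicit Defensive.

Local Open Scope classical_set_scope.
Local Open Scope ring_scope.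

(** * Means and divergences in an exponential family *)
Section ExponentialFamilyTheory.
Context {R : realType} (E : expFamily R).

Local Notation xi := (refmeas E).
Local Notation b := (logpart E).
Local Notation db := (derive1 (logpart E)).
Local Notation Theta := (param E).

Lemma density_gt0 x z : 0 < density E x z.
Proof. exact: expR_gt0. Qed.

Lemma measurable_density x :
  measurable_fun [set: measurableTypeR R] (density E x : measurableTypeR R -> R).
Proof.
apply: measurableT_comp; first exact: measurable_expR.
by apply: measurable_funB => //; exact: measurable_funM.
Qed.

Lemma integrable_density x : Theta x ->
  xi.-integrable setT (fun z : measurableTypeR R => (density E x z)%:E).
Proof.
move=> Px; apply/integrableP; split.
  by apply/measurable_EFinP; exact: measurable_density.
under eq_integral do rewrite abse_EFin ger0_norm ?(ltW (density_gt0 _ _))//.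
by rewrite (density_total Px) ltry.
Qed.

Lemma densityD x h z :
  density E (x + h) z = density E x z * expR (h * z - (b (x + h) - b x)).
Proof. by rewrite /density -expRD; congr expR; ring. Qed.

Lemma param_ball x : Theta x ->
  exists2 e, 0 < e & forall y, `|y - x| <= e -> Theta y.
Proof.
move=> Px; have /nbhs_ballP[e /= e0 He] := open_nbhs_nbhs (conj (param_open (e:=E)) Px).
exists (e / 2); first by rewrite divr_gt0.
move=> y yx; apply: He; rewrite /ball/= distrC (le_lt_trans yx)//.
by rewrite ltr_pdivrMr// ltr_pMr// ltr1n.
Qed.

(** Since the parameter set is open, the density at x times z is dominated by
    the densities at x + e and x - e, as |u| <= exp u + exp (- u). *)
Lemma integrable_mean x : Theta x ->
  xi.-integrable setT (fun z : measurableTypeR R => (z * density E x z)%:E).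
Proof.
move=> Px; have [e e0 He] := param_ball Px.
have Pp : Theta (x + e) by apply: He; rewrite addrAC subrr add0r ger0_norm// ltW.
have Pm : Theta (x + - e).
  by apply: He; rewrite addrAC subrr add0r normrN ger0_norm// ltW.
pose cp := expR (b (x + e) - b x); pose cm := expR (b (x + - e) - b x).
apply: (@le_integrable _ _ _ xi setT measurableT _
  (fun z : measurableTypeR R => ((e^-1 * cp)%:E * (density E (x + e) z)%:E
           + (e^-1 * cm)%:E * (density E (x + - e) z)%:E)%E)) => //.
- apply/measurable_EFinP; apply: measurable_funM => //.
  exact: measurable_density.
- move=> z _; rewrite -!EFinM -EFinD !abse_EFin lee_fin.
  rewrite normrM (gtr0_norm (density_gt0 _ _)) [leRHS]ger0_norm; last first.
    by rewrite addr_ge0// ?mulr_ge0 ?expR_ge0 ?invr_ge0 ?(ltW e0)//.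
  rewrite !densityD; set p := density E x z; have p0 : 0 < p by exact: density_gt0.
  rewrite 2!(expRD (_ * z)) !expRN -/cp -/cm.
  have cp0 : 0 < cp by exact: expR_gt0.
  have cm0 : 0 < cm by exact: expR_gt0.
  rewrite (_ : _ + _ = p * (e^-1 * (expR (e * z) + expR (- e * z)))); last first.
    by field; rewrite !gt_eqF.
  rewrite mulrC ler_pM2l// ler_pdivlMl//.
  have := expR_ge1Dx (e * z); have := expR_ge1Dx (- e * z).
  have := expR_gt0 (e * z); have := expR_gt0 (- e * z).
  have [z0|z0] := ger0P z; nra.
- by apply: integrableD => //; apply: integrableZl => //; exact: integrable_density.
Qed.

Definition mean x : R := fine (\int[xi]_z (z * density E x z)%:E).

Lemma meanE x : Theta x -> (\int[xi]_z (z * density E x z)%:E)%E = (mean x)%:E.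
Proof. by move=> Px; rewrite fineK//; apply: integrable_fin_num => //; exact: integrable_mean. Qed.

Lemma integral_loglik x u v : Theta x ->
  (\int[xi]_z (density E x z * (u * z - v))%:E)%E = (u * mean x - v)%:E.
Proof.
move=> Px; rewrite (eq_integral (fun z : measurableTypeR R => u%:E * (z * density E x z)%:E
    + (- v)%:E * (density E x z)%:E)%E); last first.
  by move=> z _; rewrite -!EFinM -EFinD; congr EFin; ring.
have ip := integrable_density Px; have im := integrable_mean Px.
rewrite integralD//; [|exact: integrableZl|exact: integrableZl].
rewrite !integralZl// meanE// density_total// mule1 -EFinM -EFinD.
by [].
Qed.

Definition bregman x y : R := b y - b x - (y - x) * db x.

(** The integrand is p (exp u - 1 - u), with p the density at x and u the
    log-ratio of the densities at y and x: its nonnegativity, and the case of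
    equality u = 0, yield the convexity of logpart and its strictness. *)
Lemma integral_expR_gap x y : Theta x -> Theta y ->
  (\int[xi]_z (density E y z - density E x z -
      density E x z * ((y - x) * z - (b y - b x)))%:E)%E
  = (b y - b x - (y - x) * mean x)%:E.
Proof.
move=> Px Py; have ipx := integrable_density Px; have ipy := integrable_density Py.
have il : xi.-integrable setT
    (fun z : measurableTypeR R => (density E x z * ((y - x) * z - (b y - b x)))%:E).
  apply: (@eq_integrable _ _ _ xi setT measurableT
    (fun z : measurableTypeR R => ((y - x)%:E * (z * density E x z)%:E
      + (- (b y - b x))%:E * (density E x z)%:E)%E)).
    by move=> z _; rewrite -!EFinM -EFinD; congr EFin; ring.
  have im := integrable_mean Px.
  by apply: integrableD => //; exact: integrableZl.
rewrite (eq_integral ((fun z : measurableTypeR R => ((density E y z)%:E - (density E x z)%:E)%E)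
    \- (fun z : measurableTypeR R => (density E x z * ((y - x) * z - (b y - b x)))%:E)%E)%E)//.
rewrite integralB//; last exact: integrableB.
rewrite integralB// !density_total// integral_loglik// -!EFinB.
by congr EFin; ring.
Qed.

Lemma expR_gapE x y z (u := (y - x) * z - (b y - b x)) :
  density E y z - density E x z - density E x z * u
  = density E x z * (expR u - (1 + u)).
Proof.
by have := densityD x (y - x) z; rewrite (addrC x) subrK -/u => ->; ring.
Qed.

Lemma expR_gap_ge0 x y z :
  0 <= density E y z - density E x z -
       density E x z * ((y - x) * z - (b y - b x)).
Proof.
by rewrite expR_gapE mulr_ge0 ?(ltW (density_gt0 _ _))// subr_ge0 expR_ge1Dx.
Qed.

Lemma subgradient_mean x y : Theta x -> Theta y ->
  0 <= b y - b x - (y - x) * mean x.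
Proof.
move=> Px Py; rewrite -lee_fin -integral_expR_gap//.
by apply: integral_ge0 => z _; rewrite lee_fin expR_gap_ge0.
Qed.

(** By subgradient_mean, y |-> logpart y - y * mean x is minimal at x, so its
    derivative vanishes there; this avoids differentiating under the integral. *)
Lemma meanE_derive x : Theta x -> mean x = db x.
Proof.
move=> Px; have [e e0 He] := param_ball Px.
pose f y := b y - y * mean x.
have inb y : y \in `]x - e, x + e[ -> Theta y.
  by rewrite in_itv/= => /andP[h1 h2]; apply: He; rewrite ler_norml; lra.
have df y : Theta y -> derivable f y 1.
  by move=> Py; apply: derivableB; [exact: logpart_derivable|exact: derivableM].
have : is_derive x 1 f 0.
  apply: (@derive1_at_min _ f (x - e) (x + e)); first by lra.
  - by move=> t /inb/df.
  - by rewrite in_itv/=; lra.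
  - by move=> t /inb Pt; have := subgradient_mean Px Pt; rewrite /f; lra.
move=> f0; have : is_derive x 1 f (db x - mean x).
  apply: is_deriveB.
    by rewrite derive1E; apply: DeriveDef => //; exact: logpart_derivable.
  rewrite -[X in is_derive _ _ _ X]mul1r.
  have -> : (fun y => y * mean x) = (mean x \*: (id : R -> R)).
    by apply/funext => y; rewrite /= mulrC.
  by rewrite mul1r -[X in is_derive _ _ _ X]mulr1; exact: is_deriveZ.
move=> f1; have := @derive_val _ _ _ _ _ _ _ f1; rewrite (@derive_val _ _ _ _ _ _ _ f0).
lra.
Qed.

Lemma bregman_ge0 x y : Theta x -> Theta y -> 0 <= bregman x y.
Proof. by move=> Px Py; rewrite /bregman -meanE_derive//; exact: subgradient_mean. Qed.

Hypothesis nondegenerate : exists m m', [/\ mean_dom E m, mean_dom E m' & m <> m'].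

(** If the divergence vanished for x <> y, the log-ratio of the densities, which
    is affine and nonconstant in z, would vanish almost everywhere; the reference
    measure would be an atom, and all the distributions would have the same mean. *)
Lemma bregman_gt0 x y : Theta x -> Theta y -> x != y -> 0 < bregman x y.
Proof.
move=> Px Py xy; rewrite lt_neqAle bregman_ge0// andbT; apply/eqP => br0.
have gap0 : ae_eq xi setT (fun z : measurableTypeR R => (density E y z - density E x z -
      density E x z * ((y - x) * z - (b y - b x)))%:E) (cst 0%E).
  apply/ae_eq_integral_abs => //.
    apply/measurable_EFinP; apply: measurable_funB.
      by apply: measurable_funB; exact: measurable_density.
    apply: measurable_funM; first exact: measurable_density.
    by apply: measurable_funB => //; exact: measurable_funM.
  under eq_integral do rewrite abse_EFin ger0_norm ?expR_gap_ge0//.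
  by rewrite integral_expR_gap// meanE_derive// -/(bregman x y) -br0.
pose z0 := (b y - b x) / (y - x).
have atom : ae_eq xi setT (fun z : measurableTypeR R => z%:E) (fun=> z0%:E).
  apply: filterS gap0 => z /(_ I) + _ => -[].
  rewrite expR_gapE => /eqP; rewrite mulf_eq0 gt_eqF ?density_gt0//=.
  have [u0 _|u0] := eqVneq ((y - x) * z - (b y - b x)) 0.
    congr EFin; rewrite /z0; apply: (canRL (mulfK _)); last by rewrite mulrC; lra.
    by rewrite subr_eq0 eq_sym.
  by rewrite subr_eq0 gt_eqF// expR_gt1Dx.
have const t : Theta t -> db t = z0.
  move=> Pt; apply: EFin_inj; rewrite -meanE_derive// -meanE//.
  rewrite (ae_eq_integral (fun z : measurableTypeR R => (z0%:E * (density E t z)%:E)%E))//.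
  - by rewrite integralZl//; [rewrite density_total// mule1|exact: integrable_density].
  - by have /integrableP[] := integrable_mean Pt.
  - by apply: measurable_funeM; apply/measurable_EFinP; exact: measurable_density.
  - by apply: filterS atom => z /(_ I) [->] _; rewrite EFinM.
have [m [m' [[t Pt <-] [t' Pt' <-]]]] := nondegenerate.
by rewrite !const.
Qed.

End ExponentialFamilyTheory.
(** * The parametrization by the mean *)
Section MeanParametrization.
Context {R : realType} (E : expFamily R).

Local Notation b := (logpart E).
Local Notation db := (derive1 (logpart E)).
Local Notation Theta := (param E).
Local Notation Mean := (mean_dom E).
Local Notation th := (theta_of E).

Definition dv m m' : R := bregman E (th m) (th m').

Lemma theta_of_spec m : Mean m -> Theta (th m) /\ db (th m) = m.
Proof. by move=> [x Px xm]; apply: (@getPex _ [set x | Theta x /\ db x = m]); exists x. Qed.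

Lemma theta_of_param m : Mean m -> Theta (th m).
Proof. by move=> /theta_of_spec[]. Qed.

Lemma db_theta_of m : Mean m -> db (th m) = m.
Proof. by move=> /theta_of_spec[]. Qed.

Lemma dvE m m' : Mean m ->
  dv m m' = b (th m') - b (th m) - (th m' - th m) * m.
Proof. by move=> Dm; rewrite /dv /bregman db_theta_of. Qed.

Lemma div_dv m m' : Mean m -> Mean m' -> div E m m' = (dv m m')%:E.
Proof.
move=> Dm Dm'; have Pm := theta_of_param Dm.
rewrite /div /KL (eq_integral (fun z : measurableTypeR R =>
   (density E (th m) z * ((th m - th m') * z - (b (th m) - b (th m'))))%:E)); last first.
  move=> z _; congr (_ * _)%:E; rewrite /density -expRN -expRD expRK; ring.
rewrite integral_loglik// meanE_derive// db_theta_of// dvE//; congr EFin; ring.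
Qed.

Lemma dv_ge0 m m' : Mean m -> Mean m' -> 0 <= dv m m'.
Proof. by move=> Dm Dm'; apply: bregman_ge0; exact: theta_of_param. Qed.

Lemma dvxx m : dv m m = 0.
Proof. by rewrite /dv /bregman !subrr mul0r subr0. Qed.

(** The last term is affine in m: it cancels when m is averaged with mean x,
    so that weighted sums of divergences can be minimized explicitly. *)
Lemma dv_three_points m x y : Mean m -> Mean x ->
  dv m y = dv m x + dv x y + (th y - th x) * (x - m).
Proof. by move=> Dm Dx; rewrite !dvE//; ring. Qed.

Hypothesis nondegenerate : exists m m', [/\ Mean m, Mean m' & m <> m'].

Lemma ltr_db x y : Theta x -> Theta y -> x < y -> db x < db y.
Proof.
move=> Px Py xy; have xNy : x != y by rewrite lt_eqF.
have yNx : y != x by rewrite gt_eqF.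
have := bregman_gt0 nondegenerate Px Py xNy.
have := bregman_gt0 nondegenerate Py Px yNx.
rewrite /bregman => h1 h2; have : 0 < (y - x) * (db y - db x) by lra.
by rewrite pmulr_rgt0 ?subr_gt0.
Qed.

Lemma dbK x : Theta x -> th (db x) = x.
Proof.
move=> Px; have Dx : Mean (db x) by exists x.
have [Pt tx] := theta_of_spec Dx; have [] := ltgtP (th (db x)) x => // lt.
  by have := ltr_db Pt Px lt; rewrite tx ltxx.
by have := ltr_db Px Pt lt; rewrite tx ltxx.
Qed.

Lemma ler_theta_of m m' : Mean m -> Mean m' -> m <= m' -> th m <= th m'.
Proof.
move=> Dm Dm' mm'; rewrite leNgt; apply/negP => lt.
have := ltr_db (theta_of_param Dm') (theta_of_param Dm) lt.
by rewrite !db_theta_of// ltNge mm'.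
Qed.

Lemma dv_gt0 m m' : Mean m -> Mean m' -> m != m' -> 0 < dv m m'.
Proof.
move=> Dm Dm' mm'; apply: bregman_gt0 => //; try exact: theta_of_param.
by apply: contraNneq mm' => e; rewrite -(db_theta_of Dm) -(db_theta_of Dm') e.
Qed.

Lemma dv_incr m x y : Mean m -> Mean x -> Mean y ->
  m <= x -> x <= y -> dv m x <= dv m y.
Proof.
move=> Dm Dx Dy mx xy; rewrite (dv_three_points y Dm Dx) -addrA lerDl.
by rewrite addr_ge0 ?dv_ge0// mulr_ge0// subr_ge0// ler_theta_of.
Qed.

Lemma dv_decr m x y : Mean m -> Mean x -> Mean y ->
  y <= x -> x <= m -> dv m x <= dv m y.
Proof.
move=> Dm Dx Dy yx xm; rewrite (dv_three_points y Dm Dx) -addrA lerDl.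
by rewrite addr_ge0 ?dv_ge0// mulr_le0// subr_le0// ler_theta_of.
Qed.

Lemma continuous_db x : Theta x -> {for x, continuous db}.
Proof.
by move=> Px; apply/differentiable_continuous/derivable1_diffP/logpart_derivable2.
Qed.

Lemma continuous_logpart x : Theta x -> {for x, continuous b}.
Proof.
by move=> Px; apply/differentiable_continuous/derivable1_diffP/logpart_derivable.
Qed.

(** The derivative of logpart is continuous and increasing, so by the
    intermediate value theorem it maps a neighbourhood of th m onto one of m. *)
Lemma theta_of_near m e : Mean m -> 0 < e ->
  \forall y \near m, Mean y /\ `|th m - th y| <= e.
Proof.
move=> Dm e0; have Pt := theta_of_param Dm.
have [e' e'0 He'] := param_ball Pt.
pose h := Num.min e e'.
have h0 : 0 < h by rewrite lt_min e0.
have he : h <= e by rewrite ge_min lexx.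
have he' : h <= e' by rewrite ge_min lexx orbT.
set t := th m in Pt He' *.
have inP x : t - h <= x <= t + h -> Theta x.
  by move=> /andP[h1 h2]; apply: He'; rewrite ler_norml; lra.
have Pl : Theta (t - h) by apply: inP; lra.
have Pr : Theta (t + h) by apply: inP; lra.
have ml : db (t - h) < m by rewrite -(db_theta_of Dm); apply: ltr_db => //; rewrite -/t; lra.
have mr : m < db (t + h) by rewrite -(db_theta_of Dm); apply: ltr_db => //; rewrite -/t; lra.
near=> y.
have yl : db (t - h) < y by near: y; exact: lt_nbhsr.
have yr : y < db (t + h) by near: y; exact: lt_nbhsl.
have lhrh : t - h <= t + h by lra.
have [||c] := @IVT _ db _ _ y lhrh.
- apply: continuous_in_subspaceT => x; rewrite inE/= in_itv/= => /inP.
  exact: continuous_db.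
- rewrite min_l ?max_r ?(ltW yl) ?(ltW yr)//; exact/ltW/(lt_trans ml).
rewrite in_itv/= => /[dup] cin /inP Pc <-; split; first by exists c.
by rewrite dbK// ler_norml; lra.
Unshelve. all: by end_near. Qed.

Lemma mean_dom_near m : Mean m -> \forall y \near m, Mean y.
Proof. by move=> Dm; apply: filterS (theta_of_near Dm ltr01) => y []. Qed.

Lemma mean_dom_interval x y z : Mean x -> Mean z -> x <= y <= z -> Mean y.
Proof.
move=> Dx Dz /andP[xy yz]; have Px := theta_of_param Dx; have Pz := theta_of_param Dz.
have xz := ler_theta_of Dx Dz (le_trans xy yz).
have inP c : th x <= c <= th z -> Theta c by exact: (param_interval Px Pz).
have [||c] := @IVT _ db _ _ y xz.
- apply: continuous_in_subspaceT => c; rewrite inE/= in_itv/= => /inP.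
  exact: continuous_db.
- by rewrite !db_theta_of// min_l ?max_r ?xy// (le_trans xy).
by rewrite in_itv/= => /inP Pc <-; exists c.
Qed.

Lemma continuous_theta_of m : Mean m -> {for m, continuous th}.
Proof.
move=> Dm; apply/cvgrPdist_le => e e0.
by apply: filterS (theta_of_near Dm e0) => y [].
Qed.

Lemma continuous_logpart_theta m : Mean m -> {for m, continuous (b \o th)}.
Proof.
move=> Dm; apply: continuous_comp; first exact: continuous_theta_of.
exact/continuous_logpart/theta_of_param.
Qed.

Lemma continuous_dvr m y : Mean m -> Mean y -> {for y, continuous (dv m)}.
Proof.
move=> Dm Dy; rewrite /continuous_at /dv /bregman.
apply: cvgB; first by apply: cvgB; [exact: continuous_logpart_theta|exact: cvg_cst].
apply: cvgM; last exact: cvg_cst.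
by apply: cvgB; [exact: continuous_theta_of|exact: cvg_cst].
Qed.

(** Up to a function of m alone, dv m y is - th y * m plus a function of y, and
    th is bounded on the segment. *)
Lemma dv_near_uniform m lo hi e : Mean m -> Mean lo -> Mean hi -> 0 < e ->
  \forall m' \near m, Mean m' /\
    forall y, lo <= y <= hi -> `|dv m' y - dv m y| <= e.
Proof.
move=> Dm Dlo Dhi e0.
pose h x := x * th x - b (th x).
have ch : {for m, continuous h}.
  apply: cvgB; last exact: continuous_logpart_theta.
  by apply: cvgM; [exact: cvg_id|exact: continuous_theta_of].
pose H := `|th lo| + `|th hi| + 1.
have H0 : 0 < H by rewrite ltr_wpDl// addr_ge0.
have e2 : 0 < e / 2 by rewrite divr_gt0.
have e2H : 0 < e / 2 / H by rewrite divr_gt0.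
move/cvgrPdist_le/(_ _ e2) : ch => ch.
have nm : \forall x \near m, `|m - x| <= e / 2 / H.
  by have := @cvg_id _ (nbhs m); move/cvgrPdist_le/(_ _ e2H).
near=> m'.
have Dm' : Mean m' by near: m'; exact: mean_dom_near.
split => // y /andP[loy yhi].
have Dy : Mean y by apply: (mean_dom_interval Dlo Dhi); rewrite loy.
have -> : dv m' y - dv m y = (h m' - h m) - th y * (m' - m).
  by rewrite !dvE// /h; ring.
have thy : `|th y| <= H.
  have := ler_theta_of Dlo Dy loy; have := ler_theta_of Dy Dhi yhi.
  have := ler_norm (th hi); have := ler_norm (- th lo); rewrite normrN /H.
  have := normr_ge0 (th hi); have := normr_ge0 (th lo).
  by move=> *; rewrite ler_norml; lra.
apply: (le_trans (ler_normB _ _)); rewrite [leRHS]splitr lerD//.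
  by rewrite distrC; near: m'; exact: ch.
have mm' : `|m' - m| <= e / 2 / H by rewrite distrC; near: m'; exact: nm.
rewrite normrM (le_trans (ler_wpM2r _ thy))// mulrC -ler_pdivlMr//.
Unshelve. all: by end_near. Qed.

End MeanParametrization.
(** Turns finitely many local statements, one for each arm or pair of arms, into
    a single tolerance. *)
Lemma near_common_radius {R : realType} (I : finType) (f : I -> R)
    (Q : I -> R -> Prop) :
  (forall i, \forall z \near f i, Q i z) ->
  exists2 eta, 0 < eta & forall i z, `|z - f i| <= eta -> Q i z.
Proof.
move=> H; have {H} : forall i, \forall e \near 0^'+,
    forall z, `|z - f i| <= e -> Q i z.
  move=> i; have /nbhs_ballP[e /= e0 He] := H i.
  apply: filterS (nbhs_right_lt e0) => e' e'e z ze.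
  by apply: He; rewrite /ball/= distrC (le_lt_trans ze).
move=> /filter_forall H.
near (0 : R)^'+ => e; exists e => //.
by near: e; exact: H.
Unshelve. all: by end_near. Qed.

Lemma best_armP {R : realType} {K : nat} (lam : 'I_K -> R) :
  best_arm lam <> None ->
  exists2 i, best_arm lam = Some i & forall b, b != i -> lam b < lam i.
Proof.
rewrite /best_arm; case: pickP => // i /forallP H _; exists i => // b bi.
by have /implyP := H b; apply.
Qed.

Lemma best_arm_Some {R : realType} {K : nat} (lam : 'I_K -> R) i :
  (forall b, b != i -> lam b < lam i) -> best_arm lam = Some i.
Proof.
move=> H; rewrite /best_arm; case: pickP => [j /forallP Hj|/(_ i)/forallP[]]; last first.
  by move=> b; apply/implyP; exact: H.
congr Some; apply/eqP; apply: contraT => ji.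
have /implyP/(_ _) := Hj i; rewrite eq_sym => /(_ ji) h1.
by have := lt_trans h1 (H _ ji); rewrite ltxx.
Qed.

(** * Distinguishing the best arm from one other arm *)
Section PairInformation.
Context {R : realType} {K : nat} (E : expFamily R).
Implicit Types (mu w : 'I_K -> R) (i b : 'I_K).
Local Notation Mean := (mean_dom E).
Local Notation dv := (dv E).

(** The cost of moving arm i to the mean m and arm b to the mean m'. *)
Definition pair_cost mu w i b m m' : R := w i * dv (mu i) m + w b * dv (mu b) m'.

Definition pair_mean mu w i b : R := (w i * mu i + w b * mu b) / (w i + w b).

(** The smallest cost of giving the arms i and b a common mean; the minimizer is
    their weighted mean, by pair_costE below. *)
Definition pair_info mu w i b : R :=
  let x := pair_mean mu w i b in pair_cost mu w i b x x.

Hypothesis nondegenerate : exists m m', [/\ Mean m, Mean m' & m <> m'].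

Variables (mu : 'I_K -> R) (i b : 'I_K).
Hypotheses (Dmu : forall a, Mean (mu a)) (mubi : mu b <= mu i).

Lemma pair_mean_between w : 0 <= w i -> 0 <= w b -> 0 < w i + w b ->
  mu b <= pair_mean mu w i b <= mu i.
Proof.
move=> wi wb ws; rewrite /pair_mean ler_pdivlMr// ler_pdivrMr//.
have d0 : 0 <= mu i - mu b by rewrite subr_ge0.
by have := mulr_ge0 wi d0; have := mulr_ge0 wb d0; lra.
Qed.

Lemma between_mean y : mu b <= y <= mu i -> Mean y.
Proof. exact: mean_dom_interval. Qed.

(** Average dv_three_points over the two arms: the affine terms cancel at the
    weighted mean. *)
Lemma pair_costE w y : 0 <= w i -> 0 <= w b -> 0 < w i + w b ->
  pair_cost mu w i b y y
  = pair_info mu w i b + (w i + w b) * dv (pair_mean mu w i b) y.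
Proof.
move=> wi wb ws; have := between_mean (pair_mean_between wi wb ws).
rewrite /pair_info /pair_cost; set x := pair_mean _ _ _ _ => Dx.
rewrite (dv_three_points y (Dmu i) Dx) (dv_three_points y (Dmu b) Dx).
have xE : (w i + w b) * x = w i * mu i + w b * mu b.
  by rewrite mulrC /x /pair_mean divfK// gt_eqF.
apply/eqP; rewrite -subr_eq0; set t := theta_of E y; set t' := theta_of E x.
rewrite (_ : _ - _ = (t - t') * ((w i + w b) * x - (w i * mu i + w b * mu b))).
  by rewrite xE subrr mulr0.
ring.
Qed.

Lemma pair_info_attained w : 0 <= w i -> 0 <= w b ->
  exists2 y, mu b <= y <= mu i & pair_info mu w i b = pair_cost mu w i b y y.
Proof.
move=> wi wb; have [ws|] := ltP 0 (w i + w b).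
  by exists (pair_mean mu w i b) => //; exact: pair_mean_between.
move=> ws; exists (mu b); first by rewrite lexx.
have [wi0 wb0] : w i = 0 /\ w b = 0 by split; lra.
by rewrite /pair_info /pair_cost wi0 wb0 !mul0r.
Qed.

Lemma pair_info_le_cost w y : 0 <= w i -> 0 <= w b -> Mean y ->
  pair_info mu w i b <= pair_cost mu w i b y y.
Proof.
move=> wi wb Dy; have [ws|ws] := ltP 0 (w i + w b).
  rewrite pair_costE// lerDl mulr_ge0 ?(ltW ws)//; apply: dv_ge0 => //.
  exact/between_mean/pair_mean_between.
have [wi0 wb0] : w i = 0 /\ w b = 0 by split; lra.
by rewrite /pair_info /pair_cost wi0 wb0 !mul0r.
Qed.

(** Moving m and m' to a suitable common point between mu b and mu i decreases
    both divergences, by monotonicity. *)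
Lemma pair_info_le_cross w m m' : 0 <= w i -> 0 <= w b ->
  Mean m -> Mean m' -> m <= m' ->
  pair_info mu w i b <= pair_cost mu w i b m m'.
Proof.
move=> wi wb Dm Dm' mm'.
have cost_le x : pair_info mu w i b <= pair_cost mu w i b x x ->
    dv (mu i) x <= dv (mu i) m -> dv (mu b) x <= dv (mu b) m' ->
    pair_info mu w i b <= pair_cost mu w i b m m'.
  by move=> h h1 h2; apply: (le_trans h); rewrite lerD ?ler_wpM2l.
have [mui|mui] := leP (mu i) m.
  apply: (cost_le (mu i)) => //; first exact: pair_info_le_cost.
    by rewrite dvxx dv_ge0.
  by apply: dv_incr => //; exact: le_trans mm'.
have [mub|mub] := leP (mu b) m.
  by apply: (cost_le m) => //; [exact: pair_info_le_cost|exact: dv_incr].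
apply: (cost_le (mu b)) => //; first exact: pair_info_le_cost.
  by apply: dv_decr => //; exact: ltW.
by rewrite dvxx dv_ge0.
Qed.

Lemma pair_info_ge0 w : 0 <= w i -> 0 <= w b -> 0 <= pair_info mu w i b.
Proof.
move=> wi wb; have [y ybi ->] := pair_info_attained wi wb.
by have Dy := between_mean ybi; rewrite addr_ge0 ?mulr_ge0 ?dv_ge0.
Qed.

(** Both sides are minima of costs that are linear in the weights; the comparison
    is made at the minimizer for w'. The next lemma is similar. *)
Lemma pair_info_scale w w' k : 0 <= w i -> 0 <= w b -> 0 <= k ->
  k * w i <= w' i -> k * w b <= w' b ->
  k * pair_info mu w i b <= pair_info mu w' i b.
Proof.
move=> wi wb k0 hi hb.
have wi' : 0 <= w' i by apply: le_trans hi; rewrite mulr_ge0.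
have wb' : 0 <= w' b by apply: le_trans hb; rewrite mulr_ge0.
have [y ybi ->] := pair_info_attained wi' wb'.
have Dy := between_mean ybi.
apply: le_trans (ler_wpM2l k0 (pair_info_le_cost wi wb Dy)) _.
by rewrite /pair_cost mulrDr !mulrA lerD// ler_wpM2r// dv_ge0.
Qed.

Lemma pair_info_perturb_weights w w' e : 0 <= w i -> 0 <= w b ->
  0 <= w' i -> 0 <= w' b -> `|w i - w' i| <= e -> `|w b - w' b| <= e ->
  pair_info mu w i b - e * (dv (mu i) (mu b) + dv (mu b) (mu i))
  <= pair_info mu w' i b.
Proof.
move=> wi wb wi' wb' hi hb; have [y ybi ->] := pair_info_attained wi' wb'.
have Dy := between_mean ybi; have /andP[yb yi] := ybi.
have h := pair_info_le_cost wi wb Dy.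
have e0 : 0 <= e by exact: le_trans hi.
have di : 0 <= dv (mu i) y <= dv (mu i) (mu b) by rewrite dv_ge0// dv_decr.
have db' : 0 <= dv (mu b) y <= dv (mu b) (mu i) by rewrite dv_ge0// dv_incr.
move: h hi hb di db'; rewrite /pair_cost !ler_norml.
move=> h /andP[_ hi] /andP[_ hb] /andP[d1 d2] /andP[d3 d4].
have h1 : (w i - w' i) * dv (mu i) y <= e * dv (mu i) (mu b).
  exact: le_trans (ler_wpM2r d1 hi) (ler_wpM2l e0 d2).
have h2 : (w b - w' b) * dv (mu b) y <= e * dv (mu b) (mu i).
  exact: le_trans (ler_wpM2r d3 hb) (ler_wpM2l e0 d4).
lra.
Qed.

End PairInformation.
(** * The information as a minimum over pairs of arms *)
Section Information.
Context {R : realType} {K : nat} (E : expFamily R).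
Implicit Types (mu w lam : 'I_K -> R).
Local Notation Mean := (mean_dom E).
Local Notation dv := (dv E).
Local Notation pair_info := (pair_info E).

Hypothesis nondegenerate : exists m m', [/\ Mean m, Mean m' & m <> m'].

Variables (mu : 'I_K -> R) (i : 'I_K).
Hypotheses (Dmu : forall a, Mean (mu a)) (mui : forall b, b != i -> mu b < mu i).

Let mu_le b : b != i -> mu b <= mu i. Proof. by move=> /mui/ltW. Qed.

Lemma cost_div w lam : (forall a, Mean (lam a)) ->
  (\sum_a (w a)%:E * div E (mu a) (lam a))%E
  = (\sum_a w a * dv (mu a) (lam a))%:E.
Proof.
move=> Dlam; rewrite -sumEFin; apply: eq_bigr => a _.
by rewrite div_dv// EFinM.
Qed.

(** In an alternative some arm b beats i, and the cost is at least that of the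
    two arms i and b. *)
Lemma info_ge w c : (forall a, 0 <= w a) ->
  (forall b, b != i -> c <= pair_info mu w i b) -> (c%:E <= info E mu w)%E.
Proof.
move=> w0 H; apply: le_ereal_inf_tmp => _ [lam [[Dlam lamN0] lamNmu] <-].
rewrite cost_div// lee_fin.
have [b blam lamb] := best_armP lamN0.
have bi : b != i.
  by apply/eqP => bi; apply: lamNmu; rewrite blam bi (best_arm_Some mui).
have ib : i != b by rewrite eq_sym.
apply: le_trans (H b bi) _.
apply: le_trans (pair_info_le_cross nondegenerate Dmu (mu_le bi) (w0 i) (w0 b)
  (Dlam i) (Dlam b) (ltW (lamb _ ib))) _.
rewrite (bigD1 i)//= (bigD1 b)//= addrA /pair_cost lerDl sumr_ge0// => a _.
by rewrite mulr_ge0// dv_ge0.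
Qed.

(** Lifting b slightly above y makes arm i lose; lifting the best arm of the
    result once more breaks the ties, since an alternative must have a unique
    best arm. *)
Lemma alternative_near b y e : b != i -> mu b <= y <= mu i -> 0 < e ->
  exists2 lam, Alt E mu lam &
    forall a, dv (mu a) (lam a) <=
      dv (mu a) (if (a == i) || (a == b) then y else mu a) + e.
Proof.
move=> bi ybi e0; have Dy := mean_dom_interval nondegenerate (Dmu b) (Dmu i) ybi.
pose t a := if (a == i) || (a == b) then y else mu a.
have Dt a : Mean (t a) by rewrite /t; case: ifP.
have [|eta eta0 Heta] := @near_common_radius _ _ t
    (fun a z => Mean z /\ dv (mu a) z <= dv (mu a) (t a) + e).
  move=> a; have := continuous_dvr nondegenerate (Dmu a) (Dt a).
  move/cvgrPdist_le/(_ _ e0) => H; near=> z; split.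
    by near: z; exact: mean_dom_near.
  have : `|dv (mu a) (t a) - dv (mu a) z| <= e by near: z.
  by rewrite ler_norml; lra.
pose h := eta / 2; have h0 : 0 < h by rewrite divr_gt0.
pose l0 a := if a == b then y + h else t a.
pose j := [arg max_(j > i) l0 j]%O.
have jmax a : l0 a <= l0 j by rewrite /j; case: arg_maxP => // j' _; apply.
have ji : j != i.
  apply/eqP => ji; have := jmax b; rewrite ji /l0 eqxx eq_sym (negPf bi) /t eqxx /=.
  by lra.
pose lam a := if a == j then l0 a + h else l0 a.
have lamt a : `|lam a - t a| <= eta.
  have /andP[t1 t2] : t a <= l0 a <= t a + h.
    rewrite /l0; case: eqP => [->|_]; last by rewrite lexx lerDl ltW.
    by rewrite /t eqxx orbT lexx lerDl ltW.
  have /andP[t3 t4] : l0 a <= lam a <= l0 a + h.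
    by rewrite /lam; case: ifP => _; rewrite lexx lerDl ltW.
  have hh : h + h = eta by rewrite /h -splitr.
  by rewrite ler_norml; apply/andP; split; lra.
have lamj a : a != j -> lam a < lam j.
  by move=> aj; rewrite /lam eqxx (negPf aj) (le_lt_trans (jmax a))// ltrDl.
exists lam => [|a]; last by have [] := Heta a _ (lamt a).
have bl := best_arm_Some lamj; split; first split.
- by move=> a; have [] := Heta a _ (lamt a).
- by rewrite bl.
- by rewrite bl (best_arm_Some mui) => -[/eqP]; rewrite (negPf ji).
Unshelve. all: by end_near. Qed.

Lemma info_le w c : simplex w -> (c%:E <= info E mu w)%E ->
  forall b, b != i -> c <= pair_info mu w i b.
Proof.
move=> [w0 w1] H b bi.
have [y ybi ->] := pair_info_attained E (mu_le bi) (w0 i) (w0 b).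
apply/ler_addgt0Pr => e e0; have [lam Alam dlam] := alternative_near bi ybi e0.
have Dlam : forall a, Mean (lam a) by case: Alam => -[].
have : (c%:E <= (\sum_a w a * dv (mu a) (lam a))%:E)%E.
  by rewrite -cost_div//; apply: le_trans H _; apply: ereal_inf_lbound; exists lam.
rewrite lee_fin => /le_trans; apply.
rewrite -[X in _ + X]mul1r -w1 mulr_suml.
have -> : pair_cost E mu w i b y y = \sum_a w a *
    dv (mu a) (if (a == i) || (a == b) then y else mu a).
  rewrite (bigD1 i)//= (bigD1 b)//= !eqxx orbT/= big1 ?addr0//.
  by move=> a /andP[/negPf-> /negPf->]/=; rewrite dvxx mulr0.
rewrite -big_split/= ler_sum// => a _.
by rewrite -mulrDr ler_wpM2l.
Qed.

Hypothesis other_arm : exists b : 'I_K, b != i.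

Lemma info_fin_num w : simplex w -> info E mu w \is a fin_num.
Proof.
move=> sw; have [w0 w1] := sw; have [b bi] := other_arm.
have h0 : (0%:E <= info E mu w)%E.
  apply: info_ge => // a ai.
  by apply: pair_info_ge0 => //; exact: mu_le.
rewrite ge0_fin_numE// ltNge leye_eq; apply/eqP => hoo.
have : pair_info mu w i b + 1 <= pair_info mu w i b.
  by apply: info_le => //; rewrite hoo leey.
by rewrite gerDl ler10.
Qed.

(** The information is finite on the simplex; real values are more convenient
    for continuity and arithmetic. *)
Definition rinfo w : R := fine (info E mu w).

Lemma infoE w : simplex w -> info E mu w = (rinfo w)%:E.
Proof. by move=> sw; rewrite fineK// info_fin_num. Qed.

Lemma rinfo_geP w c : simplex w ->
  c <= rinfo w <-> forall b, b != i -> c <= pair_info mu w i b.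
Proof.
move=> sw; rewrite -lee_fin -infoE//; split; first exact: info_le.
by have [w0 _] := sw; exact: info_ge.
Qed.

Lemma rinfo_le w b : simplex w -> b != i -> rinfo w <= pair_info mu w i b.
Proof. by move=> sw; apply: (rinfo_geP _ sw).1. Qed.

Lemma rinfo_ge0 w : simplex w -> 0 <= rinfo w.
Proof.
move=> sw; apply/rinfo_geP => // b bi; have [w0 _] := sw.
by apply: pair_info_ge0 => //; exact: mu_le.
Qed.

Lemma rinfo_perturb : exists M, forall w w' e, simplex w -> simplex w' ->
  (forall a, `|w a - w' a| <= e) -> `|rinfo w - rinfo w'| <= e * M.
Proof.
pose M := \sum_a (dv (mu i) (mu a) + dv (mu a) (mu i)).
exists M.
have half w w' e : simplex w -> simplex w' ->
    (forall a, `|w a - w' a| <= e) -> rinfo w - e * M <= rinfo w'.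
  move=> sw sw' ww'; apply/rinfo_geP => // b bi.
  have [w0 _] := sw; have [w0' _] := sw'.
  apply: le_trans (pair_info_perturb_weights nondegenerate Dmu (mu_le bi) (w0 i)
    (w0 b) (w0' i) (w0' b) (ww' i) (ww' b)).
  rewrite lerB ?rinfo_le// ler_wpM2l ?(le_trans _ (ww' b))//.
  rewrite /M (bigD1 b)//= lerDl sumr_ge0// => a _.
  by rewrite addr_ge0 ?dv_ge0.
move=> w w' e sw sw' ww'.
have h1 := half _ _ _ sw sw' ww'.
have h2 : rinfo w' - e * M <= rinfo w by apply: half => // a; rewrite distrC.
by rewrite ler_norml; lra.
Qed.

End Information.
(** * Existence, uniqueness and stability of the optimal weights *)
Section SimplexTopology.
Context {R : realType} {K : nat}.

Lemma simplex_le1 (w : 'I_K -> R) a : simplex w -> w a <= 1.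
Proof. by move=> [w0 <-]; rewrite (bigD1 a)//= lerDl sumr_ge0. Qed.

(** The simplex as a set of row vectors, whose topology has the compactness and
    extreme value theorems. *)
Definition simplex_rV : set 'rV[R]_K := [set v | simplex (v ord0)].

Lemma compact_simplex_rV : compact simplex_rV.
Proof.
have cube : compact [set v : 'rV[R]_K | forall i, v ord0 i \in `[0, 1]].
  by apply: (@rV_compact _  _ (fun=> `[(0 : R), 1]%classic)) => _; exact: segment_compact.
apply: subclosed_compact cube _ => [|v /= sv i]; last first.
  by rewrite in_itv/= simplex_le1// andbT; case: sv.
have -> : simplex_rV = \bigcap_a [set v : 'rV[R]_K | 0 <= v ord0 a]
      `&` [set v : 'rV[R]_K | \sum_a v ord0 a = 1].
    apply/seteqP; split=> v /= [h1 h2]; split => //; first by move=> a _; exact: h1.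
    by move=> a; exact: h1.
  apply: closedI.
    apply: closed_bigI => a _.
    apply: (@preimage_closed _ _ (fun v : 'rV[R]_K => v ord0 a) [set x | 0 <= x]).
      by move=> v _; exact: coord_continuous.
    exact: closed_ge.
  have csum : continuous (fun v : 'rV[R]_K => \sum_a v ord0 a).
    apply: (@continuous_big R _ _ _ predT _ _ _ (fun a (v : 'rV[R]_K) => v ord0 a)).
      exact: add_continuous.
    by move=> a _; exact: coord_continuous.
  apply: (@preimage_closed _ _ (fun v : 'rV[R]_K => \sum_a v ord0 a) [set x | x = 1]).
    by move=> v _; exact: csum.
  exact: closed_eq.
Qed.

Lemma rV_coord_near (v : 'rV[R]_K) (e : R) : 0 < e ->
  \forall u \near v, forall a, `|v ord0 a - (u : 'rV[R]_K) ord0 a| <= e.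
Proof.
move=> e0; apply/nbhs_ballP; exists e => //= u [_ H] a.
by have /= := H ord0 a; rewrite /ball/= => /ltW.
Qed.

Lemma row_coordE (w : 'I_K -> R) : (\row_a w a) ord0 = w.
Proof. by apply/funext => a; rewrite mxE. Qed.

End SimplexTopology.

Section OptimalWeights.
Context {R : realType} {K : nat} (E : expFamily R).
Implicit Types (mu w lam : 'I_K -> R).
Local Notation Mean := (mean_dom E).
Local Notation dv := (dv E).
Local Notation pair_info := (pair_info E).

Hypothesis nondegenerate : exists m m', [/\ Mean m, Mean m' & m <> m'].
Variables (mu : 'I_K -> R) (i : 'I_K).
Hypotheses (Dmu : forall a, Mean (mu a)) (mui : forall b, b != i -> mu b < mu i).
Hypothesis other_arm : exists b : 'I_K, b != i.

Local Notation rinfo := (rinfo E mu).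

Let mu_le b : b != i -> mu b <= mu i. Proof. by move=> /mui/ltW. Qed.

Lemma continuous_rinfo :
  {within simplex_rV, continuous (fun v : 'rV[R]_K => rinfo (v ord0))}.
Proof.
have [M HM] := rinfo_perturb nondegenerate Dmu mui other_arm.
apply/subspace_continuousP => v Sv; apply/cvgrPdist_le => e e0.
rewrite near_withinE; have eM : 0 < e / (`|M| + 1) by rewrite divr_gt0// ltr_pwDr.
apply: filterS (rV_coord_near v eM) => u vu Su.
apply: le_trans (HM _ _ _ Sv Su vu) _.
rewrite mulrAC ler_pdivrMr ?ltr_pwDr// ler_wpM2l ?(ltW e0)//.
by rewrite (le_trans (ler_norm _))// lerDl.
Qed.

Definition maximizer w := simplex w /\ forall w', simplex w' -> rinfo w' <= rinfo w.

Lemma simplex_nonempty : exists w : 'I_K -> R, simplex w.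
Proof.
exists (fun a => (a == i)%:R); split; first by move=> a; rewrite ler0n.
by rewrite (bigD1 i)//= eqxx big1 ?addr0// => a /negPf->.
Qed.

Lemma maximizer_exists : exists w, maximizer w.
Proof.
have [w sw] := simplex_nonempty.
have S0 : simplex_rV (R := R) (K := K) !=set0.
  by exists (\row_a w a); rewrite /simplex_rV/= row_coordE.
have [v Sv vmax] := EVT_max_rV S0 compact_simplex_rV continuous_rinfo.
exists (v ord0); split; first by rewrite inE in Sv.
move=> w' sw'; have := vmax (\row_a w' a); rewrite row_coordE; apply.
by rewrite inE /simplex_rV/= row_coordE.
Qed.

Lemma maximizerP w : simplex w -> maximizer w <-> info E mu w = Tstar_inv E mu.
Proof.
move=> sw; have infoE := infoE nondegenerate Dmu mui other_arm.
split.
  move=> [_ wmax]; apply/eqP; rewrite eq_le; apply/andP; split.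
    by apply: ereal_sup_ubound; exists w.
  apply: ge_ereal_sup => _ [w' sw' <-].
  by rewrite !infoE// lee_fin wmax.
move=> wT; split => // w' sw'; rewrite -lee_fin -!infoE// wT.
by apply: ereal_sup_ubound; exists w'.
Qed.

Lemma wstar_maximizer : maximizer (wstar E mu).
Proof.
have [w wmax] := maximizer_exists; have [sw _] := wmax.
have [] : simplex (wstar E mu) /\ info E mu (wstar E mu) = Tstar_inv E mu.
  rewrite /wstar; apply: (@getPex _ [set w | simplex w /\ info E mu w = Tstar_inv E mu]).
  by exists w; split => //; exact: (maximizerP sw).1.
by move=> sws; exact: (maximizerP sws).2.
Qed.

Lemma wstar_simplex : simplex (wstar E mu).
Proof. by case: wstar_maximizer. Qed.

Lemma Tstar_invE : Tstar_inv E mu = (rinfo (wstar E mu))%:E.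
Proof.
have [sw wmax] := wstar_maximizer.
rewrite -((maximizerP sw).1 (conj sw wmax)).
exact: (infoE nondegenerate Dmu mui other_arm).
Qed.

Hypothesis rinfo_gt0 : 0 < rinfo (wstar E mu).

Lemma maximizer_gt0 w : maximizer w -> 0 < rinfo w.
Proof. by move=> [_ wmax]; apply: lt_le_trans rinfo_gt0 _; apply/wmax/wstar_simplex. Qed.

Lemma pair_info_gt0_weights w b : simplex w -> b != i ->
  0 < pair_info mu w i b -> 0 < w i /\ 0 < w b.
Proof.
move=> [w0 _] bi; apply: contraPP => /not_andP H; apply/negP; rewrite -leNgt.
have [wi|wb] : w i = 0 \/ w b = 0.
  by case: H => /negP; rewrite -leNgt => h; [left|right]; apply/eqP; rewrite eq_le h w0.
- apply: le_trans (pair_info_le_cost nondegenerate Dmu (mu_le bi) (w0 i) (w0 b) (Dmu b)) _.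
  by rewrite /pair_cost wi mul0r dvxx mulr0 addr0.
- apply: le_trans (pair_info_le_cost nondegenerate Dmu (mu_le bi) (w0 i) (w0 b) (Dmu i)) _.
  by rewrite /pair_cost wb mul0r dvxx mulr0 addr0.
Qed.

(** If one comparison had slack at a maximizer, moving a little weight from that
    arm to all the others, in proportion, would improve every other comparison. *)
Lemma maximizer_equalizes w b : maximizer w -> b != i ->
  pair_info mu w i b = rinfo w.
Proof.
move=> wM bi; have c0 := maximizer_gt0 wM; have [sw wmax] := wM.
have [w0 w1] := sw; apply/eqP; rewrite eq_le rinfo_le// andbT leNgt.
apply/negP => slack; set c := rinfo w in c0 slack wmax *.
set f := pair_info mu w i b in slack *.
have f0 : 0 < f by apply: lt_trans slack.
have [wi wb] := pair_info_gt0_weights sw bi f0.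
have wb1 : 0 < 1 - w b.
  rewrite subr_gt0 -w1 (bigD1 b)//= ltrDl (bigD1 i) 1?eq_sym//=.
  by rewrite ltr_pwDl// sumr_ge0.
(* the weight of b is multiplied by 1 - k, which keeps its comparison above c,
   and the other weights by 1 + s so that the total stays 1 *)
pose k := (f - c) / (2 * f); have k0 : 0 < k by rewrite divr_gt0 ?subr_gt0// mulr_gt0.
have kf : k * f = (f - c) / 2 by rewrite /k; field; rewrite gt_eqF.
have k1 : k <= 1 by rewrite /k ler_pdivrMr ?mulr_gt0//; lra.
pose s := k * w b / (1 - w b); have s0 : 0 < s by rewrite divr_gt0// mulr_gt0.
have sE : s * (1 - w b) = k * w b by rewrite /s divfK// gt_eqF.
pose w' a := if a == b then (1 - k) * w b else (1 + s) * w a.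
have sw' : simplex w'.
  split=> [a|]; first by rewrite /w'; case: ifP => _; rewrite mulr_ge0//; lra.
  rewrite (bigD1 b)//= /w' eqxx.
  rewrite (eq_bigr (fun a => (1 + s) * w a)); last by move=> a /negPf->.
  rewrite -mulr_sumr; have : \sum_(a | a != b) w a = 1 - w b.
    by have := w1; rewrite (bigD1 b)//= => <-; rewrite addrAC subrr add0r.
  by move=> ->; rewrite [X in _ + X]mulrDl sE; ring.
have ib : i != b by rewrite eq_sym.
pose c' := Num.min ((1 + s) * c) ((1 - k) * f).
have : c' <= rinfo w'.
  apply/(rinfo_geP nondegenerate Dmu mui other_arm) => // a ai.
  have [ab|ab] := eqVneq a b.
    rewrite ge_min ab; apply/orP; right.
    apply: (pair_info_scale nondegenerate Dmu (mu_le bi)) => //; first by lra.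
      by rewrite /w' (negPf ib) ler_wpM2r//; lra.
    by rewrite /w' eqxx.
  apply: (@le_trans _ _ ((1 + s) * pair_info mu w i a)).
    by rewrite ge_min ler_pM2l ?rinfo_le//; lra.
  apply: (pair_info_scale nondegenerate Dmu (mu_le ai)) => //; first by lra.
    by rewrite /w' (negPf ib).
  by rewrite /w' (negPf ab).
apply/negP; rewrite -ltNge; apply: le_lt_trans (wmax _ sw') _.
by rewrite lt_min mulrDl mul1r ltrDl mulr_gt0//= mulrBl mul1r kf; lra.
Qed.

(** Two maximizers and their average are all maximizers, so they equalize all
    comparisons at the same level. As the cost at a common point y is linear in
    the weights and has a unique minimizer, the three minimizers coincide for
    each pair, which determines the ratio of the two weights. *)
Lemma maximizer_unique w w' : maximizer w -> maximizer w' -> w = w'.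
Proof.
move=> wM w'M; have [sw wmax] := wM; have [sw' w'max] := w'M.
have [w0 w1] := sw; have [w0' w1'] := sw'.
have cc' : rinfo w' = rinfo w by apply/eqP; rewrite eq_le wmax ?w'max.
have c0 := maximizer_gt0 wM.
pose m a := (w a + w' a) / 2.
have sm : simplex m.
  split=> [a|]; first by rewrite divr_ge0// addr_ge0.
  by rewrite -mulr_suml big_split/= w1 w1' divff.
have pos b : b != i -> [/\ 0 < w i, 0 < w b, 0 < w' i & 0 < w' b].
  move=> bi; have [] := pair_info_gt0_weights sw bi _.
    by rewrite maximizer_equalizes.
  have [] := pair_info_gt0_weights sw' bi _; last by split.
  by rewrite maximizer_equalizes// cc'.
(* the averaged weights are optimal too, so none of the comparisons improves *)
have mM : maximizer m.
  split => // v sv; apply: le_trans (wmax _ sv) _.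
  apply/(rinfo_geP nondegenerate Dmu mui other_arm) => // b bi.
  have [y ybi ->] := pair_info_attained E (mu_le bi) (sm.1 i) (sm.1 b).
  have Dy := between_mean nondegenerate Dmu ybi.
  have := pair_info_le_cost nondegenerate Dmu (mu_le bi) (w0 i) (w0 b) Dy.
  have := pair_info_le_cost nondegenerate Dmu (mu_le bi) (w0' i) (w0' b) Dy.
  by rewrite !maximizer_equalizes// cc' /pair_cost /m; lra.
have same b : b != i -> pair_mean mu w i b = pair_mean mu w' i b.
  move=> bi; have [wi wb wi' wb'] := pos _ bi.
  have ws : 0 < w i + w b by rewrite addr_gt0.
  have ws' : 0 < w' i + w' b by rewrite addr_gt0.
  have [y ybi yE] := pair_info_attained E (mu_le bi) (sm.1 i) (sm.1 b).
  have Dy := between_mean nondegenerate Dmu ybi.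
  have := maximizer_equalizes mM bi; rewrite yE.
  have -> : rinfo m = rinfo w by apply/eqP; rewrite eq_le wmax ?mM.2.
  have := pair_costE nondegenerate Dmu (mu_le bi) y (ltW wi) (ltW wb) ws.
  have := pair_costE nondegenerate Dmu (mu_le bi) y (ltW wi') (ltW wb') ws'.
  rewrite !maximizer_equalizes// cc' /pair_cost /m.
  have Dx := between_mean nondegenerate Dmu
    (pair_mean_between (mu_le bi) (ltW wi) (ltW wb) ws).
  have Dx' := between_mean nondegenerate Dmu
    (pair_mean_between (mu_le bi) (ltW wi') (ltW wb') ws').
  move=> e' e em.
  have : (w i + w b) * dv (pair_mean mu w i b) y
    + (w' i + w' b) * dv (pair_mean mu w' i b) y <= 0 by lra.
  have [->|xy] := eqVneq (pair_mean mu w i b) y.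
    have [->//|xy'] := eqVneq (pair_mean mu w' i b) y.
    have := mulr_gt0 ws' (dv_gt0 nondegenerate Dx' Dy xy').
    by rewrite dvxx mulr0 add0r => h /(lt_le_trans h); rewrite ltxx.
  have := mulr_gt0 ws (dv_gt0 nondegenerate Dx Dy xy).
  have := mulr_ge0 (ltW ws') (dv_ge0 Dx' Dy); lra.
have [b0 b0i] := other_arm; have [wi _ wi' _] := pos _ b0i.
have prop b : w b * w' i = w' b * w i.
  have [->|bi] := eqVneq b i; first by rewrite mulrC.
  have [_ wb _ wb'] := pos _ bi.
  have ws : 0 < w i + w b by rewrite addr_gt0.
  have ws' : 0 < w' i + w' b by rewrite addr_gt0.
  have ne : w i + w b != 0 by rewrite gt_eqF.
  have ne' : w' i + w' b != 0 by rewrite gt_eqF.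
  have /eqP := same _ bi; rewrite /pair_mean eqr_div// => /eqP h.
  have : (w b * w' i - w' b * w i) * (mu i - mu b) = 0 by lra.
  move/eqP; rewrite mulf_eq0 [X in _ || X]subr_eq0 [X in _ || X]gt_eqF ?mui// orbF.
  by rewrite subr_eq0 => /eqP.
have wii : w' i = w i.
  by rewrite -[LHS]mul1r -[RHS]mul1r -{1}w1 -w1' !mulr_suml; apply: eq_bigr => b _.
apply/funext => b; have := prop b; rewrite wii => /mulIf; apply.
by rewrite gt_eqF.
Qed.

(** For each arm, the weights that differ from the optimal ones by e at that arm
    form a compact set, on which the maximum of the information is attained and,
    by uniqueness, smaller than the optimum. *)
Lemma near_maximizer e : 0 < e ->
  exists2 om, 0 < om & forall w, simplex w ->
    rinfo (wstar E mu) - om <= rinfo w ->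
    forall a, `|w a - wstar E mu a| <= e.
Proof.
move=> e0; set ws := wstar E mu; set c := rinfo ws.
have [sws wsmax] : maximizer ws := wstar_maximizer.
suff H : forall a, \forall om \near 0^'+, forall w, simplex w ->
    c - om <= rinfo w -> `|w a - ws a| <= e.
  move/filter_forall : H => H.
  near (0 : R)^'+ => om; exists om => // w sw h a.
  have Hom : forall a w, simplex w -> c - om <= rinfo w -> `|w a - ws a| <= e.
    by near: om; exact: H.
  exact: Hom.
move=> a.
pose far := simplex_rV `&` [set v : 'rV[R]_K | e <= `|v ord0 a - ws a|].
have [far0|/set0P/negP/negPn/eqP far0] := pselect (far !=set0); last first.
  near=> om => w sw _; rewrite leNgt; apply/negP => /ltW h.
  have : far (\row_a w a) by rewrite /far/= /simplex_rV/= row_coordE.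
  by rewrite far0.
have cfar : compact far.
  apply: compact_closedI; first exact: compact_simplex_rV.
  have cdist : continuous (fun v : 'rV[R]_K => `|v ord0 a - ws a|).
    have cabs : continuous (fun x : R => `|x - ws a|).
      by move=> x; apply: cvg_norm; apply: cvgB; [exact: cvg_id|exact: cvg_cst].
    move=> v; apply: (@continuous_comp _ _ _ (fun v : 'rV[R]_K => v ord0 a)
      (fun x : R => `|x - ws a|)).
      exact: coord_continuous.
    exact: cabs.
  apply: (@preimage_closed _ _ (fun v : 'rV[R]_K => `|v ord0 a - ws a|) [set x | e <= x]).
    by move=> v _; exact: cdist.
  exact: closed_ge.
have fs : far `<=` simplex_rV by move=> v [].
have [v + vmax] := EVT_max_rV far0 cfar (continuous_subspaceW fs continuous_rinfo).
rewrite inE => -[Sv ve].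
have vlt : rinfo (v ord0) < c.
  rewrite lt_neqAle wsmax// andbT; apply/eqP => vc.
  have vM : maximizer (v ord0) by split => // w' sw'; rewrite vc; exact: wsmax.
  have vws := maximizer_unique vM wstar_maximizer.
  by move: ve; rewrite /= vws subrr normr0 leNgt e0.
near=> om => w sw h; rewrite leNgt; apply/negP => /ltW far_w.
have := vmax (\row_a w a); rewrite row_coordE inE /far/= /simplex_rV/= row_coordE.
move=> /(_ (conj sw far_w)) /(le_trans h).
rewrite lerBlDl leNgt => /negP; apply.
by rewrite -ltrBrDr; near: om; apply: nbhs_right_lt; rewrite subr_gt0.
Unshelve. all: by end_near. Qed.

End OptimalWeights.
Section MeanPerturbation.
Context {R : realType} {K : nat} (E : expFamily R).
Implicit Types (mu w lam : 'I_K -> R).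
Local Notation Mean := (mean_dom E).
Local Notation dv := (dv E).
Local Notation pair_info := (pair_info E).

Hypothesis nondegenerate : exists m m', [/\ Mean m, Mean m' & m <> m'].
Variables (mu : 'I_K -> R) (i : 'I_K).
Hypotheses (Dmu : forall a, Mean (mu a)) (mui : forall b, b != i -> mu b < mu i).

Let mu_le b : b != i -> mu b <= mu i. Proof. by move=> /mui/ltW. Qed.

(** The minimizing points of both sides lie in one fixed segment, on which the
    divergences are uniformly close by dv_near_uniform. *)
Lemma pair_info_perturb_means e : 0 < e ->
  exists2 eta, 0 < eta & forall mu', (forall a, `|mu' a - mu a| <= eta) ->
  [/\ forall a, Mean (mu' a), forall b, b != i -> mu' b < mu' i &
    forall w b, (forall a, 0 <= w a) -> b != i ->
      `|pair_info mu' w i b - pair_info mu w i b| <= (w i + w b) * e].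
Proof.
move=> e0.
(* a first radius keeps the means in the domain and in the same order, the
   midpoints serving as separators *)
have [|eta1 eta10 H1] := @near_common_radius _ _ mu (fun a z => Mean z /\
    forall b, b != i -> (a = i -> (mu b + mu i) / 2 < z) /\
                        (a = b -> z < (mu b + mu i) / 2)).
  move=> a; near=> z; split; first by near: z; exact: mean_dom_near.
  near: z; apply: filter_forall => b; have [->|bi] := eqVneq b i.
    exact: nearW.
  have bi2 : mu b < (mu b + mu i) / 2 < mu i by have := mui bi; lra.
  have /andP[hb hi] := bi2; have [->|ai] := eqVneq a i.
    near=> z => _; split => [_|ib]; last by rewrite ib eqxx in bi.
    by near: z; exact: lt_nbhsr.
  have [->|ab] := eqVneq a b.
    near=> z => _; split => [bi'|_]; first by rewrite bi' eqxx in bi.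
    by near: z; exact: lt_nbhsl.
  by apply: nearW => z _; split => /eqP; rewrite ?(negPf ai) ?(negPf ab).
have D1 a s : `|s| <= eta1 -> Mean (mu a + s).
  by move=> h; have [] := H1 a (mu a + s) _; rewrite ?[_ + s]addrC ?addrK.
have DM b : Mean (mu b - eta1) by apply: D1; rewrite normrN gtr0_norm.
have DP : Mean (mu i + eta1) by apply: D1; rewrite gtr0_norm.
have [|eta2 eta20 H2] := @near_common_radius _ ('I_K * 'I_K)%type (fun ab => mu ab.1)
    (fun ab z => Mean z /\ forall y, mu ab.2 - eta1 <= y <= mu i + eta1 ->
                 `|dv z y - dv (mu ab.1) y| <= e).
  by move=> [a b]/=; exact: dv_near_uniform.
pose eta := Num.min eta1 eta2.
have h1 : eta <= eta1 by rewrite ge_min lexx.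
have h2 : eta <= eta2 by rewrite ge_min lexx orbT.
exists eta; first by rewrite lt_min eta10.
move=> mu' mm'.
have mm1 a : `|mu' a - mu a| <= eta1 by exact: le_trans h1.
have mm2 a : `|mu' a - mu a| <= eta2 by exact: le_trans h2.
have Dmu' a : Mean (mu' a) by have [] := H1 a _ (mm1 a).
have mui' b : b != i -> mu' b < mu' i.
  move=> bi; have [_ /(_ b bi)[/(_ erefl) hi _]] := H1 i _ (mm1 i).
  have [_ /(_ b bi)[_ /(_ erefl) hb]] := H1 b _ (mm1 b).
  exact: lt_trans hb hi.
split => // w b w0 bi.
have close y : mu b - eta1 <= y <= mu i + eta1 ->
    `|pair_cost E mu' w i b y y - pair_cost E mu w i b y y| <= (w i + w b) * e.
  move=> yb; have [_ /(_ y yb) hi] := H2 (i, b) _ (mm2 i).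
  have [_ /(_ y yb) hb] := H2 (b, b) _ (mm2 b).
  rewrite /pair_cost opprD addrACA -!mulrBr mulrDl.
  apply: le_trans (ler_normD _ _) _; rewrite !normrM (ger0_norm (w0 i)) (ger0_norm (w0 b)).
  by rewrite lerD// ler_wpM2l.
have [y /andP[yb yi] yE] := pair_info_attained E (mu_le bi) (w0 i) (w0 b).
have [y' /andP[yb' yi'] yE'] := pair_info_attained E (ltW (mui' _ bi)) (w0 i) (w0 b).
have Dy : Mean y by apply: mean_dom_interval (Dmu b) (Dmu i) _ => //; rewrite yb.
have Dy' : Mean y'.
  by apply: mean_dom_interval (Dmu' b) (Dmu' i) _ => //; rewrite yb'.
have := pair_info_le_cost nondegenerate Dmu (mu_le bi) (w0 i) (w0 b) Dy'.
have := pair_info_le_cost nondegenerate Dmu' (ltW (mui' _ bi)) (w0 i) (w0 b) Dy.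
have /close : mu b - eta1 <= y <= mu i + eta1.
  by rewrite (le_trans _ yb) ?(le_trans yi)//; [rewrite lerDl ltW|rewrite gerBl ltW].
have /close : mu b - eta1 <= y' <= mu i + eta1.
  have := mm1 i; have := mm1 b; rewrite !ler_norml => /andP[q1 _] /andP[_ q2].
  by apply/andP; split; lra.
rewrite -yE -yE' !ler_norml => /andP[q1 q2] /andP[q3 q4].
move: q1 q2 q3 q4; move: (pair_cost _ _ _ _ _ _ _) (pair_cost _ _ _ _ _ _ _).
move: (pair_info _ _ _ _) (pair_info _ _ _ _) ((w i + w b) * e) => r1 r2 r3 r4 r5.
by move=> q1 q2 q3 q4 q5 q6; apply/andP; split; lra.
Unshelve. all: by end_near. Qed.

Hypothesis other_arm : exists b : 'I_K, b != i.
Hypothesis rinfo_gt0 : 0 < rinfo E mu (wstar E mu).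

(** When the means move, the information changes little, uniformly in the
    weights: the optimal weights for nearby means are nearly optimal for mu. *)
Lemma wstar_continuous e : 0 < e ->
  exists2 eta, 0 < eta & forall mu', (forall a, `|mu' a - mu a| <= eta) ->
    bandits E mu' /\ forall a, `|wstar E mu' a - wstar E mu a| <= e.
Proof.
move=> e0; have [om om0 Hom] := near_maximizer nondegenerate Dmu mui other_arm rinfo_gt0 e0.
have om4 : 0 < om / 4 by rewrite divr_gt0.
have [eta eta0 Heta] := pair_info_perturb_means om4.
exists eta => // mu' /Heta[Dmu' mui' Hpair].
split; first by split => //; rewrite (best_arm_Some mui').
have [sw wmax] := wstar_maximizer nondegenerate Dmu mui other_arm.
have [sw' wmax'] := wstar_maximizer nondegenerate Dmu' mui' other_arm.
set w := wstar E mu in sw wmax *; set w' := wstar E mu' in sw' wmax' *.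
have le1 (v : 'I_K -> R) b : simplex v -> b != i -> v i + v b <= 1.
  move=> [v0 <-] bi; rewrite (bigD1 i)//= (bigD1 b)//= addrA lerDl.
  by rewrite sumr_ge0.
have close v b : simplex v -> b != i ->
    `|pair_info mu' v i b - pair_info mu v i b| <= om / 4.
  move=> sv bi; apply: le_trans (Hpair v b _ bi) _; first by case: sv.
  by rewrite -[leRHS]mul1r ler_wpM2r ?le1// ltW.
have up v : simplex v -> rinfo E mu v - om / 4 <= rinfo E mu' v.
  move=> sv; apply/(rinfo_geP nondegenerate Dmu' mui' other_arm) => // b bi.
  have := rinfo_le nondegenerate Dmu mui other_arm sv bi.
  have := close v b sv bi; rewrite ler_norml => /andP[].
  move: (rinfo _ _ _) (pair_info _ _ _ _) (pair_info _ _ _ _) => r1 r2 r3.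
  by lra.
have dn v : simplex v -> rinfo E mu' v - om / 4 <= rinfo E mu v.
  move=> sv; apply/(rinfo_geP nondegenerate Dmu mui other_arm) => // b bi.
  have := rinfo_le nondegenerate Dmu' mui' other_arm sv bi.
  have := close v b sv bi; rewrite ler_norml => /andP[].
  move: (rinfo _ _ _) (pair_info _ _ _ _) (pair_info _ _ _ _) => r1 r2 r3.
  by lra.
suff h : rinfo E mu w - om <= rinfo E mu w' by exact: (Hom _ sw' h).
have combine (r1 r2 r3 r4 : R) : r1 - om / 4 <= r2 -> r2 <= r4 -> r4 - om / 4 <= r3 ->
    r1 - om <= r3 by move=> h1 h2 h3; lra.
exact: combine (up _ sw) (wmax' _ sw) (dn _ sw').
Qed.

End MeanPerturbation.

(** * Lower bound on the stopping statistic *)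
Section LikelihoodRatio.
Context {R : realType} {K : nat} (E : expFamily R).
Variables (A : nat -> 'I_K) (X : nat -> R) (t : nat).
Local Notation Mean := (mean_dom E).
Local Notation dv := (dv E).
Local Notation N := (draws A t).
Local Notation m := (emp_mean A X t).
Local Notation b_ := (logpart E).
Local Notation th := (theta_of E).

Lemma draws_emp_mean a : (N a)%:R * m a = \sum_(1 <= s < t.+1 | A s == a) X s.
Proof.
rewrite /emp_mean; have [N0|N0] := eqVneq (N a) 0%N; last first.
  by rewrite mulrA divff ?mul1r// pnatr_eq0.
rewrite N0 mul0r; move: N0; rewrite /draws => /eqP; rewrite sum_nat_seq_eq0 => /allP H.
rewrite big_seq_cond big_pred0// => s; apply/negP => /andP[sin As].
by have := H s sin; rewrite As.
Qed.

(** The log-likelihood of the unconstrained maximizer. *)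
Definition max_loglik a : R := (N a)%:R * (th (m a) * m a - b_ (th (m a))).

(** The likelihood depends on the sample only through its size and its mean. *)
Lemma likelihood_dv a x : Mean (m a) -> Mean x ->
  likelihood E x (rewards A X t a) = expR (max_loglik a - (N a)%:R * dv (m a) x).
Proof.
move=> Dm Dx; rewrite /likelihood /rewards big_map big_filter.
rewrite (_ : iota 1 t = index_iota 1 t.+1); last by rewrite /index_iota subn1.
rewrite -expR_sum; congr expR.
rewrite big_split/= -mulr_sumr -draws_emp_mean.
have -> : \sum_(1 <= s < t.+1 | A s == a) - b_ (th x) = - ((N a)%:R * b_ (th x)).
  rewrite big_mkcond/= /draws natr_sum mulr_suml -sumrN; apply: eq_bigr => s _.
  by case: ifP => _; rewrite ?mul1r// mul0r oppr0.
by rewrite /max_loglik dvE//; ring.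
Qed.

(** The numerator is the unconstrained maximum of the likelihood since the
    empirical means are in the right order; each likelihood in the denominator
    loses at least pair_info in exponent, by pair_info_le_cross. *)
Lemma glr_ge i b : (exists m m', [/\ Mean m, Mean m' & m <> m']) ->
  b != i -> Mean (m i) -> Mean (m b) -> m b <= m i ->
  ((pair_info E m (fun a => (N a)%:R) i b)%:E <= glr E A X t i b)%E.
Proof.
move=> nd ib Di Db bi; rewrite /glr.
set xi := rewards A X t i; set xb := rewards A X t b.
set w := fun a => (N a)%:R : R.
pose S := max_loglik i + max_loglik b; set c := pair_info _ _ _ _ _.
have likE x y : Mean x -> Mean y ->
    likelihood E x xi * likelihood E y xb = expR (S - pair_cost E m w i b x y).
  by move=> Dx Dy; rewrite !likelihood_dv// -expRD; congr expR; rewrite /S /pair_cost; ring.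
have cost_ge0 x y : Mean x -> Mean y -> 0 <= pair_cost E m w i b x y.
  by move=> Dx Dy; rewrite addr_ge0// mulr_ge0 ?dv_ge0.
set Lge := sup_likelihood _ _ _ _; set Lle := sup_likelihood _ _ _ _.
have ge1 : ((expR S)%:E <= Lge)%E.
  apply: ereal_sup_ubound; exists (m i, m b) => //=.
  by rewrite likE// /pair_cost !dvxx !mulr0 addr0 subr0.
have ge2 : (Lge <= (expR S)%:E)%E.
  apply: ge_ereal_sup => _ [[x y] /= [Dx Dy _] <-].
  by rewrite likE// lee_fin ler_expR gerBl cost_ge0.
have le1 : ((expR (S - pair_cost E m w i b (m i) (m i)))%:E <= Lle)%E.
  by apply: ereal_sup_ubound; exists (m i, m i) => //=; rewrite likE.
have le2 : (Lle <= (expR (S - c))%:E)%E.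
  apply: ge_ereal_sup => _ [[x y] /= [Dx Dy xy] <-].
  rewrite likE// lee_fin ler_expR lerB// /c.
  pose mu' a := if a == i then m i else if a == b then m b else m i.
  have -> : pair_info E m w i b = pair_info E mu' w i b.
    by rewrite /pair_info /pair_cost /pair_mean /mu' !eqxx (negPf ib).
  have -> : pair_cost E m w i b x y = pair_cost E mu' w i b x y.
    by rewrite /pair_cost /mu' !eqxx (negPf ib).
  apply: pair_info_le_cross => //; rewrite /w ?ler0n//.
    by move=> a; rewrite /mu'; do 2 case: ifP => _ //.
  by rewrite /mu' !eqxx (negPf ib).
have Lgefin : Lge = (expR S)%:E by apply/eqP; rewrite eq_le ge1 ge2.
have Lle_fin : Lle \is a fin_num.
  by rewrite ge0_fin_numE ?(le_lt_trans le2) ?ltry//; apply: le_trans le1; rewrite lee_fin expR_ge0.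
move: le1 le2; rewrite -(fineK Lle_fin) !lee_fin; set l := fine _ => le1 le2.
have l0 : 0 < l by apply: lt_le_trans le1; exact: expR_gt0.
rewrite Lgefin inver gt_eqF// -EFinM lne_EFin ?divr_gt0 ?expR_gt0// lee_fin.
rewrite -[leLHS]expRK ler_ln ?posrE ?expR_gt0 ?divr_gt0 ?expR_gt0//.
rewrite ler_pdivlMr//; apply: le_trans (ler_wpM2l (expR_ge0 _) le2) _.
by rewrite -expRD addrC subrK.
Qed.

Lemma chernoff_ge i c : (exists m m', [/\ Mean m, Mean m' & m <> m']) ->
  (forall a, Mean (m a)) -> (forall b, b != i -> m b < m i) ->
  (forall b, b != i -> c <= pair_info E m (fun a => (N a)%:R) i b) ->
  (c%:E <= chernoff E A X t)%E.
Proof.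
move=> nd Dm mi H; rewrite /chernoff.
apply: (le_trans _ (le_bigmax _ _ i)); apply: le_bigmin => [|b bi]; first exact: leey.
by apply: le_trans (glr_ge nd bi (Dm i) (Dm b) (ltW (mi _ bi))); rewrite lee_fin H.
Qed.

End LikelihoodRatio.
(** * Exploration and tracking by the sampling rules *)
Section Tracking.
Context {R : realType} {K : nat}.
Implicit Types (A : nat -> 'I_K) (W V : nat -> 'I_K -> R) (w v : 'I_K -> R).

Lemma drawsS A t a : draws A t.+1 a = (draws A t a + (A t.+1 == a))%N.
Proof. by rewrite /draws big_nat_recr. Qed.

Lemma draws0 A a : draws A 0 a = 0%N.
Proof. by rewrite /draws big_geq. Qed.

Lemma sum_draws A t : (\sum_a draws A t a)%N = t.
Proof.
elim: t => [|t IH]; first by rewrite big1// => a _; rewrite draws0.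
under eq_bigr do rewrite drawsS.
by rewrite big_split/= IH (bigD1 (A t.+1))//= eqxx big1 ?addn0 ?addn1// => a /negPf;
   rewrite eq_sym => ->.
Qed.

Lemma draws_le A t a : (draws A t a <= t)%N.
Proof. by rewrite -[leqRHS](sum_draws A t) (bigD1 a)//= leq_addr. Qed.

Lemma sum_drawsR A t : \sum_a (draws A t a)%:R = t%:R :> R.
Proof. by rewrite -natr_sum sum_draws. Qed.

(** The best score is at least the average one. *)
Lemma best_score_ge0 (score : 'I_K -> R) a :
  (forall b, score b <= score a) -> 0 <= \sum_b score b -> 0 <= score a.
Proof.
move=> best s0; rewrite leNgt; apply/negP => neg; move: s0; apply/negP.
rewrite -ltNge; apply: (@le_lt_trans _ _ (score a)); last by [].
rewrite (bigD1 a)//= gerDl sumr_le0// => b _; exact: le_trans (best b) (ltW neg).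
Qed.

(** Mixing w with the uniform weights, in proportion K * eps of the latter, gives
    a competitor of the projection at distance at most K * eps. *)
Lemma Linf_proj_close eps w v a : 0 <= eps -> K%:R * eps <= 1 -> simplex w ->
  is_Linf_proj eps w v -> `|v a - w a| <= K%:R * eps.
Proof.
move=> eps0 Keps [w0 w1] [_ vmin].
pose u a := eps + (1 - K%:R * eps) * w a.
have k0 : 0 <= 1 - K%:R * eps by rewrite subr_ge0.
have u1 : \sum_a u a = 1.
  rewrite big_split/= -mulr_sumr w1 sumr_const card_ord -[X in X + _]mulr_natl.
  by ring.
have ueps b : eps <= u b by rewrite lerDl mulr_ge0.
have su : simplex_ge eps u.
  split => // b; rewrite ueps/= -u1 (bigD1 b)//= lerDl sumr_ge0// => c _.
  exact: le_trans (ueps c).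
have wle1 b : w b <= 1 by rewrite -w1 (bigD1 b)//= lerDl sumr_ge0.
apply: (@le_trans _ _ (Linf_dist v w)); first exact: (le_bigmax _ (fun a => `|v a - w a|)).
apply: le_trans (vmin _ su) _; apply: bigmax_le => [|b _]; first by rewrite mulr_ge0.
have K1 : (1 : R) <= K%:R by rewrite ler1n (leq_ltn_trans _ (ltn_ord b)).
have p1 : eps <= K%:R * eps by rewrite ler_peMl.
have p2 : 0 <= K%:R * eps * w b <= K%:R * eps.
  by rewrite !mulr_ge0//= ler_piMr// mulr_ge0.
move/andP: p2 => [p2 p3].
by rewrite /u ler_norml; apply/andP; split; lra.
Qed.

(** Makes the sum of the exploration rates telescope. *)
Lemma sqrt_step (s : nat) : (Num.sqrt (s.+1%:R : R))^-1 / 2 <=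
  Num.sqrt s.+1%:R - Num.sqrt s%:R.
Proof.
set x := Num.sqrt _; set y := Num.sqrt _.
have x0 : 0 < x by rewrite sqrtr_gt0 ltr0n.
have xy : y <= x by rewrite ler_sqrt ?ler_nat ?ltr0n.
have y0 : 0 <= y by exact: sqrtr_ge0.
have xx : x * x = y * y + 1.
  by rewrite -!expr2 !sqr_sqrtr// -natr1.
rewrite ler_pdivrMr// -[X in X <= _]mul1r ler_pdivrMr//.
have : 0 <= (x - y) * (x - y) by rewrite mulr_ge0 ?subr_ge0.
lra.
Qed.

Hypothesis K0 : (0 < K)%N.

Local Notation eps_seq := (@eps_seq R K).

Lemma eps_seq_gt0 s : 0 < eps_seq s.
Proof.
by rewrite /Defs.eps_seq divr_gt0// invr_gt0 sqrtr_gt0 ltr0n addn_gt0 expn_gt0 K0.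
Qed.

Lemma eps_seq_K s : K%:R * eps_seq s <= 1.
Proof.
have K0' : 0 < (K%:R : R) by rewrite ltr0n.
have h : K%:R <= Num.sqrt (K ^ 2 + s)%:R :> R.
  rewrite -[leLHS](ger0_norm (ltW K0')) -sqrtr_sqr.
  by rewrite ler_sqrt ?ltr0n ?addn_gt0 ?expn_gt0 ?K0// natrD natrX lerDl.
rewrite /Defs.eps_seq mulrA ler_pdivrMr// mul1r ler_pdivrMr ?(lt_le_trans K0')//.
by apply: (le_trans h); rewrite ler_peMl ?ler1n// (le_trans _ h)// ltW.
Qed.

Lemma sum_eps_seq_le t : \sum_(0 <= s < t) eps_seq s <= Num.sqrt t%:R.
Proof.
elim: t => [|t IH]; first by rewrite big_geq// sqrtr_ge0.
rewrite big_nat_recr//= -[leRHS](subrK (Num.sqrt t%:R)) addrC lerD//.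
apply: le_trans (sqrt_step t); rewrite ler_pM2r// lef_pV2 ?posrE ?sqrtr_gt0 ?ltr0n//.
  rewrite ler_sqrt ?ltr0n ?addn_gt0 ?expn_gt0 ?K0// ler_nat -addn1 addnC leq_add2r.
  by rewrite expn_gt0 K0.
by rewrite addn_gt0 expn_gt0 K0.
Qed.

Lemma sum_eps_seq_ge t : t%:R / (2 * (K%:R + Num.sqrt t%:R))
  <= \sum_(0 <= s < t) eps_seq s.
Proof.
have K0' : 0 < (K%:R : R) by rewrite ltr0n.
have -> : t%:R / (2 * (K%:R + Num.sqrt t%:R))
    = \sum_(0 <= s < t) (2 * (K%:R + Num.sqrt t%:R))^-1 :> R.
  by rewrite sumr_const_nat subn0 mulr_natl.
rewrite big_seq [leRHS]big_seq ler_sum// => s; rewrite mem_index_iota => /andP[_ st].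
have q0 : 0 < Num.sqrt (K ^ 2 + s)%:R :> R.
  by rewrite sqrtr_gt0 ltr0n addn_gt0 expn_gt0 K0.
rewrite /Defs.eps_seq -invfM [_ * 2]mulrC lef_pV2 ?posrE ?mulr_gt0 ?ltr_wpDr ?sqrtr_ge0//.
rewrite ler_pM2l// -[leRHS]ger0_norm ?addr_ge0 ?sqrtr_ge0// -sqrtr_sqr.
rewrite ler_sqrt ?exprn_gt0 ?ltr_wpDr ?sqrtr_ge0//.
rewrite sqrrD sqr_sqrtr// natrD natrX addrAC -addrA lerD2l.
rewrite ler_wpDr ?ler_nat ?(ltnW st)// mulrn_wge0// mulr_ge0 ?sqrtr_ge0//.
Qed.

Section Cumulative.
Variables (A : nat -> 'I_K) (W V : nat -> 'I_K -> R).
Hypothesis Wsimplex : forall t, simplex (W t).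
Hypothesis VW : forall s, is_Linf_proj (eps_seq s) (W s) (V s).
Hypothesis best : forall t b,
  \sum_(0 <= s < t.+1) V s b - (draws A t b)%:R <=
  \sum_(0 <= s < t.+1) V s (A t.+1) - (draws A t (A t.+1))%:R.

Let V_ge s a : eps_seq s <= V s a.
Proof. by have [[/(_ a)/andP[]]] := VW s. Qed.

(** The arm that is drawn had a nonnegative score, hence is at most one draw ahead
    of its target; the others only see their target increase. *)
Lemma cumulative_upper t a : (draws A t a)%:R <= \sum_(0 <= s < t) V s a + 1.
Proof.
elim: t => [|t IH]; first by rewrite draws0 big_geq// add0r.
rewrite drawsS; have [<-|] := eqVneq (A t.+1) a; last first.
  move=> _; rewrite addn0 (le_trans IH)// lerD2r big_nat_recr//= lerDl.
  exact: le_trans (ltW (eps_seq_gt0 _)) (V_ge _ _).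
have : 0 <= \sum_(0 <= s < t.+1) V s (A t.+1) - (draws A t (A t.+1))%:R.
  apply: (best_score_ge0 (score := fun b => \sum_(0 <= s < t.+1) V s b - (draws A t b)%:R)).
    exact: best.
  rewrite sumrB sum_drawsR exchange_big/=.
  rewrite (eq_bigr (fun=> 1)); last by move=> s _; have [[]] := VW s.
  by rewrite sumr_const_nat subn0 -natr1 addrAC subrr add0r.
by rewrite subr_ge0 addn1 -natr1 lerD2r.
Qed.

(** The draws and the targets have the same sum over the arms, so cumulative_upper
    for the other arms bounds the delay of arm a. *)
Lemma cumulative_lower t a : \sum_(0 <= s < t) V s a - K%:R <= (draws A t a)%:R.
Proof.
have := sum_drawsR A t; rewrite (bigD1 a)//= => tE.
have VE : \sum_b \sum_(0 <= s < t) V s b = t%:R :> R.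
  rewrite exchange_big/= (eq_bigr (fun=> 1)); last by move=> s _; have [[]] := VW s.
  by rewrite sumr_const_nat subn0.
have : \sum_(b | b != a) (draws A t b)%:R
    <= \sum_(b | b != a) (\sum_(0 <= s < t) V s b) + K%:R.
  apply: (@le_trans _ _ (\sum_(b | b != a) (\sum_(0 <= s < t) V s b + 1))).
    by apply: ler_sum => b _; exact: cumulative_upper.
  rewrite big_split/= lerD2l sumr_const -mulr_natl mulr1 ler_nat.
  by rewrite -[leqRHS]card_ord max_card.
move: VE; rewrite (bigD1 a)//=.
by move: tE => <-; lra.
Qed.

Lemma cumulative_explores t a :
  (t%:R / (2 * (K%:R + Num.sqrt t%:R)) - K%:R <= (draws A t a)%:R :> R).
Proof.
apply: le_trans (cumulative_lower t a); rewrite lerD2r.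
by apply: le_trans (sum_eps_seq_ge t) _; rewrite ler_sum.
Qed.

(** Before L the weights are bounded by 1, afterwards by v a + e; the projections
    shift them by at most K times the exploration rates. *)
Lemma cumulative_tracks v L e : (forall a, 0 <= v a + e) ->
  (forall t a, (L <= t)%N -> W t a <= v a + e) ->
  forall t a, (draws A t a)%:R <= t%:R * (v a + e) + L%:R + K%:R * Num.sqrt t%:R + 1.
Proof.
move=> ve H t a; apply: le_trans (cumulative_upper t a) _; rewrite lerD2r.
apply: (@le_trans _ _ (\sum_(0 <= s < t) (W s a + K%:R * eps_seq s))).
  apply: ler_sum => s _; rewrite -lerBlDl.
  have := Linf_proj_close a (ltW (eps_seq_gt0 s)) (eps_seq_K s) (Wsimplex s) (VW s).
  exact: le_trans (ler_norm _).
rewrite big_split/= -mulr_sumr lerD ?ler_wpM2l ?sum_eps_seq_le//.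
elim: t => [|t IH]; first by rewrite big_geq// addr_ge0 ?mul0r.
have [Lt|tL] := leqP L t.
  rewrite big_nat_recr//= -natr1 mulrDl mul1r -addrA [_ + L%:R]addrC addrA.
  by rewrite lerD ?H.
apply: (@le_trans _ _ (\sum_(0 <= s < t.+1) 1)).
  by apply: ler_sum => s _; have [w0 <-] := Wsimplex s;
     rewrite (bigD1 a)//= lerDl sumr_ge0.
by rewrite sumr_const_nat subn0 ler_wpDl ?mulr_ge0// ler_nat.
Qed.

End Cumulative.

Section Direct.
Variables (A : nat -> 'I_K) (W : nat -> 'I_K -> R).
Hypothesis Wsimplex : forall t, simplex (W t).
Let under t := [set a | (draws A t a)%:R < Num.sqrt (t%:R : R) - K%:R / 2]%SET.
Hypothesis forced : forall t, under t != finset.set0 ->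
  A t.+1 \in under t /\ forall b, b \in under t -> (draws A t (A t.+1) <= draws A t b)%N.
Hypothesis best : forall t, under t = finset.set0 -> forall b,
  t%:R * W t b - (draws A t b)%:R <= t%:R * W t (A t.+1) - (draws A t (A t.+1))%:R.

(** After L an arm is drawn only if it is below its target or below sqrt t. *)
Lemma direct_tracks v L e : (forall a, 0 <= v a + e) ->
  (forall t a, (L <= t)%N -> W t a <= v a + e) ->
  forall t a, (draws A t a)%:R <= t%:R * (v a + e) + L%:R + Num.sqrt t%:R + 1.
Proof.
move=> ve H; elim=> [|t IH] a.
  by rewrite draws0 mul0r add0r sqrtr0 addr0 addr_ge0.
have tSt : Num.sqrt t%:R <= Num.sqrt t.+1%:R :> R by rewrite ler_sqrt ?ltr0n// ler_nat.
have p0 : 0 <= t%:R * (v a + e) by rewrite mulr_ge0.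
have s0 : 0 <= Num.sqrt t%:R :> R by exact: sqrtr_ge0.
have L0 : 0 <= L%:R :> R by [].
have pS : t.+1%:R * (v a + e) = t%:R * (v a + e) + (v a + e) by rewrite -natr1 mulrDl mul1r.
have vea := ve a.
rewrite pS drawsS; have [aE|] := eqVneq (A t.+1) a; last first.
  by rewrite addn0; have := IH a; lra.
rewrite addn1 -natr1; have [Lt|tL] := leqP L t; last first.
  have : (draws A t a)%:R + 1 <= L%:R :> R.
    by rewrite natr1 ler_nat (leq_ltn_trans (draws_le _ _ _)).
  by lra.
have [U0|U0] := eqVneq (under t) finset.set0.
  have : 0 <= t%:R * W t a - (draws A t a)%:R.
    rewrite -aE; apply: (best_score_ge0 (score := fun b => t%:R * W t b - (draws A t b)%:R)).
      exact: best.
    by rewrite sumrB sum_drawsR -mulr_sumr (Wsimplex t).2 mulr1 subrr.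
  have : t%:R * W t a <= t%:R * (v a + e) by rewrite ler_wpM2l// H.
  by lra.
have [+ _] := forced U0; rewrite aE inE.
have : 0 <= K%:R / 2 :> R by rewrite divr_ge0.
by lra.
Qed.

(** Between the times (m+K)^2 and (m+1+K)^2 the arms drawn only m times are
    underdrawn, so each round draws one of them; there are more rounds than arms. *)
Lemma direct_explores m : forall t a, ((m + K) ^ 2 <= t)%N -> (m <= draws A t a)%N.
Proof.
have mono t t' a : (t <= t')%N -> (draws A t a <= draws A t' a)%N.
  move=> /subnK <-; elim: (t' - t)%N => // k IH.
  by rewrite addSn drawsS (leq_trans IH)// leq_addr.
elim: m => // m IH.
pose t0 := ((m + K) ^ 2)%N.
pose lag t := (\sum_a (m.+1 - draws A t a))%N.
have step t : (t0 <= t)%N -> (lag t.+1 <= (lag t).-1)%N.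
  move=> t0t; have le b : (m.+1 - draws A t.+1 b <= m.+1 - draws A t b)%N.
    by rewrite leq_sub2l// mono.
  have [lag0|lag_gt] := posnP (lag t).
    by rewrite lag0/= -lag0 /lag; apply: leq_sum => b _.
  have [b bm] : exists b, draws A t b = m.
    move: lag_gt; rewrite lt0n /lag sum_nat_eq0 negb_forall => /existsP[b].
    rewrite implyTb subn_eq0 -ltnNge ltnS => h; exists b.
    by apply/eqP; rewrite eqn_leq h IH.
  have bU : b \in under t.
    rewrite inE bm; have : (m + K)%:R <= Num.sqrt t%:R :> R.
      have t_gt0 : 0 < (t%:R : R).
        by rewrite ltr0n (leq_trans _ t0t)// expn_gt0 addn_gt0 K0 orbT.
      rewrite -[leLHS]ger0_norm// -sqrtr_sqr -natrX ler_sqrt//.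
      by rewrite ler_nat.
    have : 0 < K%:R / 2 :> R by rewrite divr_gt0// ltr0n.
    by rewrite natrD; lra.
  have U0 : under t != finset.set0 by apply/set0Pn; exists b.
  have [_ /(_ b bU)] := forced U0; rewrite bm => Am.
  have {}Am : draws A t (A t.+1) = m by apply/eqP; rewrite eqn_leq Am IH.
  rewrite -ltnS prednK// /lag (bigD1 (A t.+1))//= [X in (_ < X)%N](bigD1 (A t.+1))//=.
  rewrite -addSn leq_add//; last by apply: leq_sum => c _.
  by rewrite drawsS eqxx Am addn1 subnn subSnn.
have lagK j : (lag (t0 + j) <= K - j)%N.
  elim: j => [|j IHj].
    rewrite addn0 subn0 -[leqRHS]card_ord -sum1_card; apply: leq_sum => b _.
    by rewrite leq_subLR addn1 ltnS IH.
  rewrite addnS (leq_trans (step _ (leq_addr _ _)))//.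
  by rewrite subnS -!subn1 leq_sub2r.
move=> t a ht; apply: (@leq_trans (draws A (t0 + K) a)); last first.
  apply: mono; apply: leq_trans ht; rewrite /t0 addSn.
  move: (leq_addl m K); move: (m + K)%N => q Kq; rewrite -[q.+1]addn1 sqrnD -addnA.
  by rewrite leq_add2l exp1n muln1 mul2n -addnn addnCA (leq_trans Kq)// leq_addr.
have := lagK K; rewrite subnn leqn0 /lag sum_nat_eq0 => /forallP/(_ a).
by rewrite subn_eq0.
Qed.

End Direct.
End Tracking.
(** * Conditioning on the past by change of measure *)
Section WeightedMeasure.
Local Open Scope ereal_scope.
Context d (T : measurableType d) (R : realType).
Variables (m : {measure set T -> \bar R}) (g : T -> R).

Definition weighted of measurable_fun setT g & (forall x, (0 <= g x)%R) : set T -> \bar R :=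
  fun B => \int[m]_(x in B) (g x)%:E.

Hypotheses (mg : measurable_fun setT g) (g0 : forall x, (0 <= g x)%R).
Local Notation wm := (weighted mg g0).

Let weighted0 : wm set0 = 0. Proof. exact: integral_set0. Qed.

Let weighted_ge0 B : 0 <= wm B.
Proof. by apply: integral_ge0 => x _; rewrite lee_fin. Qed.

Let mgE : measurable_fun setT (EFin \o g).
Proof. exact/measurable_EFinP. Qed.

Let weighted_sigma_additive : semi_sigma_additive wm.
Proof. by apply: semi_sigma_additive_nng_induced => // x; rewrite lee_fin. Qed.

HB.instance Definition _ := isMeasure.Build _ _ _ wm
  weighted0 weighted_ge0 weighted_sigma_additive.

Import HBNNSimple.

(** Weighted measures replace conditional expectations: a conditional law is
    identified by the values of such a measure on events, then integrated. *)
Lemma integral_weighted f : measurable_fun setT f -> (forall x, 0 <= f x) ->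
  \int[wm]_x f x = \int[m]_x (f x * (g x)%:E).
Proof.
move=> mf f0; pose f_ := nnsfun_approx measurableT mf.
have mfg (h : T -> \bar R) : measurable_fun setT h -> measurable_fun setT (fun x => h x * (g x)%:E).
  by move=> mh; exact: emeasurable_funM.
have mf_ n : measurable_fun setT (EFin \o f_ n).
  by apply/measurable_EFinP; exact: measurable_funP.
have cvf x : EFin \o f_ ^~ x @ \oo --> f x by apply: cvg_nnsfun_approx.
transitivity (limn (fun n => \int[wm]_x (f_ n x)%:E)).
  rewrite -monotone_convergence//.
  - by apply: eq_integral => y _; apply/esym/cvg_lim => //; exact: cvf.
  - by move=> n y _; rewrite lee_fin.
  - by move=> y _ k n kn; rewrite lee_fin; exact/lefP/nd_nnsfun_approx.
rewrite [X in limn X](_ : _ = (fun n => \int[m]_x ((f_ n x)%:E * (g x)%:E))).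
  rewrite -monotone_convergence//.
  - apply: eq_integral => x _; apply/cvg_lim => //.
    by apply: cvgeZr => //; exact: cvf.
  - by move=> n; apply: mfg; exact: mf_.
  - by move=> n x _; rewrite mule_ge0// lee_fin.
  - move=> x _ k n kn; rewrite lee_wpmul2r ?lee_fin//; exact/lefP/nd_nnsfun_approx.
apply/funext => n.
have mi r : measurable (f_ n @^-1` [set r]) by exact: measurable_sfunP.
transitivity (\sum_(k \in range (f_ n)) \int[wm]_x (k * \1_(f_ n @^-1` [set k]) x)%:E).
  under eq_integral do rewrite fimfunE -fsumEFin//.
  rewrite ge0_integral_fsum//.
  - by move=> y; exact/measurable_EFinP/measurable_funM.
  - by move=> y x _; rewrite ?EFinM nnfun_muleindic_ge0.
transitivity (\sum_(k \in range (f_ n)) \int[m]_x ((k * \1_(f_ n @^-1` [set k]) x)%:E * (g x)%:E)).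
  apply: eq_fsbigr => r; rewrite inE => -[x _ <-].
  rewrite integralZl_indic_nnsfun// integral_indic// setIT.
  rewrite (eq_integral (fun y => (f_ n x)%:E *
    ((\1_(f_ n @^-1` [set f_ n x]) y)%:E * (g y)%:E))); last first.
    by move=> y _; rewrite EFinM muleA.
  rewrite ge0_integralZl_EFin//; last 2 first.
  - by move=> y _; rewrite mule_ge0// lee_fin.
  - by apply: mfg; exact/measurable_EFinP.
  congr (_ * _); rewrite /= /weighted [LHS]integral_mkcond.
  apply: eq_integral => y _.
  rewrite patchE indicE; case: ifP => _; by rewrite ?mul1e ?mul0e.
rewrite -ge0_integral_fsum//.
- apply: eq_integral => x _; rewrite -ge0_mule_fsuml; last first.
    by move=> k; rewrite ?EFinM nnfun_muleindic_ge0.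
  by rewrite fsumEFin// -fimfunE.
- by move=> r; apply: mfg; apply/measurable_EFinP; exact: measurable_funM.
- move=> r x _; apply: mule_ge0; last by rewrite lee_fin.
  by rewrite EFinM nnfun_muleindic_ge0.
Qed.

End WeightedMeasure.
Section Transfer.
Local Open Scope ereal_scope.
Context d1 d2 (T1 : measurableType d1) (T2 : measurableType d2) (R : realType).
Variables (phi : T1 -> T2) (mphi : measurable_fun setT phi).
Variables (f : T2 -> \bar R) (mf : measurable_fun setT f) (f0 : forall y, 0 <= f y).

Lemma integral_law (m : {measure set T1 -> \bar R}) (n : {measure set T2 -> \bar R}) :
  (forall B, measurable B -> m (phi @^-1` B) = n B) ->
  \int[m]_x f (phi x) = \int[n]_y f y.
Proof.
move=> mn; have <- : \int[pushforward m phi]_y f y = \int[m]_x f (phi x).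
  by rewrite ge0_integral_pushforward.
by apply: eq_measure_integral => B mB _; exact: mn.
Qed.

Lemma integral_eq_law (m n : {measure set T1 -> \bar R}) :
  (forall B, measurable B -> m (phi @^-1` B) = n (phi @^-1` B)) ->
  \int[m]_x f (phi x) = \int[n]_x f (phi x).
Proof.
move=> mn; have <- : \int[pushforward n phi]_y f y = \int[n]_x f (phi x).
  by rewrite ge0_integral_pushforward.
exact: integral_law.
Qed.

End Transfer.

Section Likelihood.
Context {R : realType} {K : nat} {d : measure_display} {T : measurableType d}.
Context (E : expFamily R) (P : probability T R).
Variables (A : nat -> T -> 'I_K) (X : nat -> T -> R) (F : nat -> set (set T)).
Variables (mu : 'I_K -> R) (hmodel : bandit_model E A X P F mu).

Local Notation past t := (g_sigma_algebraType (F t)).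

Lemma measurable_past t (B : set (past t)) : measurable B <-> F t B.
Proof.
rewrite /measurable/=.
by rewrite (sigma_algebra_id (past_sigma_algebra hmodel t)).
Qed.

Lemma measurable_to_past t : measurable_fun [set: T] (id : T -> past t).
Proof.
move=> _ B /measurable_past FB; rewrite setTI.
exact: (past_measurable hmodel FB).
Qed.

Lemma past_measurable_fun t (Y : T -> R) :
  measurable_fun [set: past t] (Y : past t -> R) -> measurable_fun [set: T] Y.
Proof. by move=> mY; apply: (measurableT_comp mY (@measurable_to_past t)). Qed.

Lemma past_measurable_funS t (Y : T -> R) :
  measurable_fun [set: past t] (Y : past t -> R) ->
  measurable_fun [set: past t.+1] (Y : past t.+1 -> R).
Proof.
move=> mY _ B mB; have := mY measurableT B mB; rewrite !setTI.
move=> /measurable_past H; apply/measurable_past.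
exact: (past_nondecreasing hmodel (leqnSn t)).
Qed.

Lemma measurable_reward t :
  measurable_fun [set: past t.+1] (X t.+1 : past t.+1 -> measurableTypeR R).
Proof.
move=> _ B mB; rewrite setTI; apply/measurable_past.
exact: (reward_past hmodel).
Qed.

Lemma measurable_rewardT t : measurable_fun [set: T] (X t.+1 : T -> measurableTypeR R).
Proof. exact: (past_measurable_fun (@measurable_reward t)). Qed.

Definition drawn (t : nat) (a : 'I_K) : T -> R := \1_(A t.+1 @^-1` [set a]).

Lemma drawn_past t a : measurable_fun [set: past t] (drawn t a : past t -> R).
Proof.
apply: measurable_indic; apply/measurable_past; exact: (arm_past hmodel).
Qed.

Lemma drawn_ge0 t a x : 0 <= drawn t a x.
Proof. by rewrite /drawn indicE ler0n. Qed.

Lemma drawnE t a x : drawn t a x = (A t.+1 x == a)%:R.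
Proof. by rewrite /drawn indicE; congr (nat_of_bool _)%:R; apply/idP/eqP; rewrite inE. Qed.

Section OneDraw.
Variables (t : nat) (a : 'I_K) (Y : T -> R).
Hypotheses (mY : measurable_fun [set: past t] (Y : past t -> R)) (Y0 : forall x, 0 <= Y x).

Let mYT : measurable_fun [set: T] Y. Proof. exact: past_measurable_fun mY. Qed.

Let mdrawn : measurable_fun [set: T] (drawn t a).
Proof. exact: past_measurable_fun (@drawn_past t a). Qed.

Let mdraw_set : measurable (A t.+1 @^-1` [set a]).
Proof. by apply: (past_measurable hmodel (t := t)); exact: (arm_past hmodel). Qed.

Hypothesis Da : mean_dom E (mu a).

Lemma nu_density B : measurable B ->
  nu E (mu a) B = (fine (nu E (mu a) B))%:E /\ 0 <= fine (nu E (mu a) B).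
Proof.
move=> mB; have mp := measurable_density E (theta_of E (mu a)).
have n0 : (0 <= nu E (mu a) B)%E.
  by apply: integral_ge0 => z _; rewrite lee_fin ltW// density_gt0.
split; last exact: fine_ge0.
rewrite fineK// ge0_fin_numE//; apply: (@le_lt_trans _ _ 1%E); last exact: ltry.
rewrite -(density_total (theta_of_param Da)).
apply: ge0_subset_integral => //; first by apply/measurable_EFinP.
by move=> z _; rewrite lee_fin ltW// density_gt0.
Qed.

(** For a past event G, the probability of G, a draw of a and a reward in B is
    that of G and a draw of a, times nu B. Both sides are measures in G; integrate
    Y against them. *)
Lemma reward_event_integral (B : set (measurableTypeR R)) : measurable B ->
  (\int[P]_(x in X t.+1 @^-1` B) (Y x * drawn t a x)%:E
   = nu E (mu a) B * \int[P]_x (Y x * drawn t a x)%:E)%E.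
Proof.
move=> mB; have [nuE c0] := nu_density mB; set c := fine _ in nuE c0.
set D := A t.+1 @^-1` [set a]; set XB := X t.+1 @^-1` B.
have mXB : measurable XB by rewrite -[XB]setTI; exact: measurable_rewardT.
have mDX : measurable (D `&` XB) by exact: measurableI.
have m1 : measurable_fun [set: T] (\1_(D `&` XB) : T -> R) by exact: measurable_indic.
have p1 x : 0 <= (\1_(D `&` XB) : T -> R) x by rewrite indicE ler0n.
have m2 : measurable_fun [set: T] (fun x => c * drawn t a x).
  by apply: measurable_funM.
have p2 x : 0 <= c * drawn t a x by rewrite mulr_ge0// drawn_ge0.
have mYE : measurable_fun [set: past t] (EFin \o Y : past t -> \bar R).
  exact/measurable_EFinP.
have mYTE : measurable_fun [set: T] (EFin \o Y : T -> \bar R).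
  exact/measurable_EFinP.
have YE0 x : (0 <= (EFin \o Y) x)%E by rewrite lee_fin.
have laws G : measurable (G : set (past t)) ->
    weighted P m1 p1 (id @^-1` G) = weighted P m2 p2 (id @^-1` G).
  move=> /measurable_past FG; have mG := past_measurable hmodel FG.
  rewrite /weighted preimage_id.
  have -> : (\int[P]_(x in G) (\1_(D `&` XB) x)%:E = P (G `&` D) * c%:E)%E.
    rewrite integral_indic//= -nuE -(reward_law hmodel a FG mB).
    by congr (P _); rewrite setIC setIA.
  under eq_integral do rewrite EFinM.
  rewrite ge0_integralZl_EFin//; last 2 first.
  - by move=> x _; rewrite lee_fin drawn_ge0.
  - by apply/measurable_EFinP/measurable_funTS.
  by rewrite integral_indic// setIC muleC.
have := integral_eq_law (@measurable_to_past t) mYE YE0 laws.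
rewrite integral_weighted// integral_weighted//= => e.
rewrite integral_mkcond; transitivity (\int[P]_x ((Y x)%:E * (\1_(D `&` XB) x)%:E))%E.
  apply: eq_integral => x _; rewrite patchE /drawn !indicE in_setI.
  case: (x \in XB); last by rewrite andbF mule0.
  by rewrite andbT EFinM.
rewrite e nuE -ge0_integralZl_EFin//; last 2 first.
- by move=> x _; rewrite lee_fin mulr_ge0// drawn_ge0.
- by apply/measurable_EFinP; exact: measurable_funM.
by apply: eq_integral => x _; rewrite -!EFinM; congr EFin; rewrite mulrCA.
Qed.

(** By the previous lemma, the law of the reward under P weighted by Y and the draw
    of a is a multiple of nu; integrate f against it. *)
Lemma reward_independent (f : measurableTypeR R -> R) :
  measurable_fun setT f -> (forall z, 0 <= f z) ->
  (\int[P]_x (Y x * drawn t a x)%:E < +oo)%E ->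
  (\int[P]_x (Y x * drawn t a x * f (X t.+1 x))%:E =
   \int[P]_x (Y x * drawn t a x)%:E *
   \int[refmeas E]_z (f z * density E (theta_of E (mu a)) z)%:E)%E.
Proof.
move=> mf f0 Yoo; set I := (\int[P]_x _)%E in Yoo *.
have I0 : (0 <= I)%E.
  by apply: integral_ge0 => x _; rewrite lee_fin mulr_ge0// drawn_ge0.
pose e := fine I; have IE : I = e%:E by rewrite fineK// ge0_fin_numE.
have e0 : 0 <= e by exact: fine_ge0.
have mYd : measurable_fun [set: T] (fun x => Y x * drawn t a x) by exact: measurable_funM.
have Yd0 x : 0 <= Y x * drawn t a x by rewrite mulr_ge0// drawn_ge0.
set p := density E _.
have mp : measurable_fun setT (p : measurableTypeR R -> R) by exact: measurable_density.
have p0 z : 0 <= p z by rewrite ltW// density_gt0.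
have mep : measurable_fun setT ((fun z => e * p z) : measurableTypeR R -> R).
  exact: measurable_funM.
have ep0 (z : measurableTypeR R) : 0 <= e * p z by rewrite mulr_ge0.
have mfE : measurable_fun setT (EFin \o f) by exact/measurable_EFinP.
have fE0 z : (0 <= (EFin \o f) z)%E by rewrite lee_fin.
have laws (B : set (measurableTypeR R)) : measurable B ->
    weighted P mYd Yd0 (X t.+1 @^-1` B) = weighted (refmeas E) mep ep0 B.
  move=> mB; rewrite /weighted reward_event_integral// -/I IE /nu muleC.
  under [RHS]eq_integral do rewrite EFinM.
  rewrite ge0_integralZl_EFin//.
  - by move=> z _; rewrite lee_fin.
  - by apply/measurable_EFinP; exact: measurable_funTS.
have := integral_law (@measurable_rewardT t) mfE fE0 laws.
rewrite integral_weighted//; last first.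
  by apply: measurableT_comp => //; exact: measurable_rewardT.
rewrite integral_weighted//= => h.
transitivity (\int[P]_x ((f (X t.+1 x))%:E * (Y x * drawn t a x)%:E))%E.
  by apply: eq_integral => x _; rewrite -EFinM mulrC.
rewrite h IE -ge0_integralZl_EFin//; last 2 first.
- by move=> z _; rewrite lee_fin mulr_ge0.
- by apply/measurable_EFinP; exact: measurable_funM.
by apply: eq_integral => z _; rewrite -!EFinM; congr EFin; rewrite mulrCA.
Qed.

End OneDraw.
End Likelihood.
(** * The likelihood ratio martingale of an arm *)
Section LikelihoodMartingale.
Context {R : realType} {K : nat} {d : measure_display} {T : measurableType d}.
Context (E : expFamily R) (P : probability T R).
Variables (A : nat -> T -> 'I_K) (X : nat -> T -> R) (F : nat -> set (set T)).
Variables (mu : 'I_K -> R) (hmodel : bandit_model E A X P F mu).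
Variables (a : 'I_K) (h : R).
Hypothesis Da : mean_dom E (mu a).
Local Notation th := (theta_of E (mu a)).
Hypothesis Ph : param E (th + h).
Local Notation b := (logpart E).

Local Notation past t := (g_sigma_algebraType (F t)).

Definition tilt (z : R) : R := expR (h * z - (b (th + h) - b th)).

(** The likelihood ratio of the rewards of arm a in the first t rounds, when its
    natural parameter is shifted by h. *)
Fixpoint lr (t : nat) (x : T) : R :=
  if t is s.+1 then
    lr s x * (if A s.+1 x == a then tilt (X s.+1 x) else 1)
  else 1.

Lemma lr_gt0 t x : 0 < lr t x.
Proof.
elim: t => [|t IH] //=; rewrite mulr_gt0//.
by case: ifP => _ //; exact: expR_gt0.
Qed.

Lemma lrE t x (N := draws (A^~ x) t a) :
  lr t x = expR (N%:R * (h * emp_mean (A^~ x) (X^~ x) t a - (b (th + h) - b th))).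
Proof.
rewrite mulrBr mulrCA draws_emp_mean {}/N; elim: t => [|t IH].
  by rewrite /= draws0 big_geq// !(mul0r, mulr0) subr0 expR0.
rewrite /= IH drawsS [in RHS]big_mkcond big_nat_recr//= -big_mkcond/=.
case: ifP => _; last by rewrite addr0 addn0 mulr1.
by rewrite addn1 -natr1 /tilt -expRD; congr expR; ring.
Qed.

Lemma measurable_tilt : measurable_fun setT (tilt : measurableTypeR R -> R).
Proof.
apply: measurableT_comp; first exact: measurable_expR.
by apply: measurable_funB => //; exact: measurable_funM.
Qed.

Lemma lr_rec t x : lr t.+1 x
  = lr t x * drawn A t a x * tilt (X t.+1 x) + lr t x * (1 - drawn A t a x).
Proof.
rewrite /= drawnE; case: eqP => _; first by rewrite subrr mulr0 addr0 mulr1.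
by rewrite subr0 mulr0 mul0r add0r.
Qed.

Lemma lr_past t : measurable_fun [set: past t] (lr t : past t -> R).
Proof.
elim: t => [|t IH]; first exact: measurable_cst.
have -> : lr t.+1 = (fun x =>
    lr t x * drawn A t a x * tilt (X t.+1 x) + lr t x * (1 - drawn A t a x)).
  by apply/funext => x; exact: lr_rec.
have mlr := past_measurable_funS hmodel IH.
have mdr := past_measurable_funS hmodel (@drawn_past _ _ _ _ _ _ _ _ _ _ hmodel t a).
apply: measurable_funD.
  apply: measurable_funM; first exact: measurable_funM.
  exact: (measurableT_comp measurable_tilt (@measurable_reward _ _ _ _ _ _ _ _ _ _ hmodel t)).
by apply: measurable_funM => //; exact: measurable_funB.
Qed.

Lemma lr_measurable t : measurable_fun [set: T] (lr t).
Proof. exact: (past_measurable_fun hmodel (@lr_past t)). Qed.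

Lemma integral_tilt :
  (\int[refmeas E]_z (tilt z * density E th z)%:E = 1)%E.
Proof.
rewrite -(density_total Ph); apply: eq_integral => z _.
by rewrite -[in RHS]/(density E (th + h) z) densityD mulrC.
Qed.

(** Given the past, the factor of a new draw of a is a ratio of densities
    evaluated at a reward drawn from the denominator: its mean is 1. *)
Lemma lr_integral t : (\int[P]_x (lr t x)%:E = 1)%E.
Proof.
elim: t => [|t IH]; first by rewrite /= integral_cst// mul1e; exact: probability_setT.
have lr0 x : 0 <= lr t x by exact: ltW (lr_gt0 t x).
have dr0 x : 0 <= drawn A t a x :> R by exact: drawn_ge0.
have dr1 x : 0 <= 1 - drawn A t a x :> R.
  by rewrite drawnE subr_ge0; case: (_ == _).
have mlr := @lr_measurable t.
have mdr : measurable_fun [set: T] (drawn A t a : T -> R).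
  exact: (past_measurable_fun hmodel (@drawn_past _ _ _ _ _ _ _ _ _ _ hmodel t a)).
have mld : measurable_fun [set: T] (fun x => lr t x * drawn A t a x) by exact: measurable_funM.
have mlN : measurable_fun [set: T] (fun x => lr t x * (1 - drawn A t a x)).
  by apply: measurable_funM => //; exact: measurable_funB.
have split1 : (\int[P]_x (lr t x * drawn A t a x)%:E
    + \int[P]_x (lr t x * (1 - drawn A t a x))%:E = 1)%E.
  rewrite -ge0_integralD//; last 4 first.
  - by move=> x _; rewrite lee_fin mulr_ge0.
  - exact/measurable_EFinP.
  - by move=> x _; rewrite lee_fin mulr_ge0.
  - exact/measurable_EFinP.
  rewrite -[RHS]IH; apply: eq_integral => x _.
  by rewrite -EFinD -mulrDr addrC subrK mulr1.
have fin : (\int[P]_x (lr t x * drawn A t a x)%:E < +oo)%E.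
  apply: (@le_lt_trans _ _ 1%E); last exact: ltry.
  rewrite -split1 leeDl//; apply: integral_ge0 => x _.
  by rewrite lee_fin mulr_ge0.
have tilt0 z : 0 <= tilt z by exact: ltW (expR_gt0 _).
have := reward_independent hmodel (@lr_past t) lr0 Da measurable_tilt tilt0 fin.
rewrite integral_tilt mule1 => h1.
transitivity (\int[P]_x ((lr t x * drawn A t a x * tilt (X t.+1 x))%:E
    + (lr t x * (1 - drawn A t a x))%:E))%E.
  by apply: eq_integral => x _; rewrite lr_rec EFinD.
rewrite ge0_integralD//.
- by rewrite h1 split1.
- by move=> x _; rewrite lee_fin mulr_ge0// mulr_ge0.
- apply/measurable_EFinP; apply: measurable_funM => //.
  exact: (measurableT_comp measurable_tilt (@measurable_rewardT _ _ _ _ _ _ _ _ _ _ hmodel t)).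
- by move=> x _; rewrite lee_fin mulr_ge0.
- exact/measurable_EFinP.
Qed.

End LikelihoodMartingale.
(** * Common consequences of the two sampling rules *)
Section SamplingRules.
Context {R : realType} {K : nat} {d : measure_display} {T : measurableType d}.
Variables (A : nat -> T -> 'I_K) (W : nat -> T -> 'I_K -> R).
Hypotheses (K0 : (0 < K)%N) (Wsimplex : forall t x, simplex (W t x)).
Hypothesis sampling : C_tracking A W \/ D_tracking A W.

Lemma D_tracking_forced x : D_tracking A W ->
  let U t := [set a | (draws (A^~ x) t a)%:R < Num.sqrt (t%:R : R) - K%:R / 2]%SET in
  (forall t, U t != finset.set0 -> A t.+1 x \in U t /\
    forall b, b \in U t -> (draws (A^~ x) t (A t.+1 x) <= draws (A^~ x) t b)%N) /\
  (forall t, U t = finset.set0 -> forall b,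
     t%:R * W t x b - (draws (A^~ x) t b)%:R
     <= t%:R * W t x (A t.+1 x) - (draws (A^~ x) t (A t.+1 x))%:R).
Proof.
move=> HD U; split=> t UE; have := HD t x; rewrite /underdrawn -/(U t) /=.
  by rewrite UE.
by rewrite UE eqxx.
Qed.

Lemma exploration : exists t0, forall x t a, (t0 <= t)%N ->
  Num.sqrt t%:R / 8 <= (draws (A^~ x) t a)%:R :> R.
Proof.
exists ((8 * K + 8) ^ 2)%N => x t a t0t.
have K1 : 1 <= (K%:R : R) by rewrite ler1n.
set s := Num.sqrt _; have s0 : 0 <= s by exact: sqrtr_ge0.
have ss : s * s = t%:R by rewrite -expr2 sqr_sqrtr.
have sK : 8 * K%:R + 8 <= s.
  have q0 : 0 <= 8 * K%:R + 8 :> R by rewrite addr_ge0// mulr_ge0.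
  rewrite -[leLHS](ger0_norm q0) -sqrtr_sqr /s ler_sqrt//.
  by rewrite -natrM -natrD -natrX ler_nat.
have s_gt0 : 0 < s by lra.
case: sampling => [[V [VW best]]|/(@D_tracking_forced x)[forced _]].
  have := cumulative_explores K0 (fun s => VW s x) (fun t => best t x) t a.
  apply: le_trans; rewrite -/s.
  have -> : t%:R / (2 * (K%:R + s)) = s * (s / (2 * (K%:R + s))).
    by rewrite mulrA ss.
  have : 4 / 9 <= s / (2 * (K%:R + s)).
    by rewrite ler_pdivlMr; lra.
  move=> /(ler_wpM2l s0); lra.
pose q := Num.truncn s; have /andP[q1 q2] := truncn_itv s0.
have qs : q%:R <= s by rewrite /q; apply: q1.
have sq : s < q%:R + 1 by rewrite natr1.
have Kq : (K <= q)%N by rewrite -ltnS -(ltr_nat R) -natr1; lra.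
have qt : (q ^ 2 <= t)%N by rewrite -(ler_nat R) natrX -ss expr2 ler_pM.
have := @direct_explores R K K0 _ forced (q - K) t a.
rewrite subnK// => /(_ qt).
by rewrite -(ler_nat R) natrB//; lra.
Qed.

(** Upper bounds on the draws of all arms give lower bounds, since the draws add
    up to t. The time C (L + 1) makes L, the square root and the constants
    negligible with respect to t. *)
Lemma tracks v k : simplex v -> 0 < k -> exists2 e, 0 < e &
  exists C, forall x L, (forall t a, (L <= t)%N -> W t x a <= v a + e) ->
  forall t a, (C * (L + 1) <= t)%N ->
  t%:R * (v a - k) <= (draws (A^~ x) t a)%:R.
Proof.
move=> [v0 v1] k0; have K0' : 0 < (K%:R : R) by rewrite ltr0n.
have K1 : 1 <= (K%:R : R) by rewrite ler1n.
pose e := k / (2 * K%:R); have e0 : 0 < e by rewrite divr_gt0// mulr_gt0.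
exists e => //.
(* c1 takes care of the term in L, c2 of the term in sqrt t *)
pose c1 : R := 4 * K%:R / k; pose c2 : R := (4 * K%:R ^+ 2 / k) ^+ 2.
have c10 : 0 <= c1 by rewrite divr_ge0 ?mulr_ge0// ltW.
have c20 : 0 <= c2 by exact: sqr_ge0.
exists (Num.truncn (c1 + c2)).+1 => x L HL t a Ct.
have ve b : 0 <= v b + e by rewrite addr_ge0// ltW.
have up b : (draws (A^~ x) t b)%:R
    <= t%:R * (v b + e) + L%:R + K%:R * Num.sqrt t%:R + 1.
  case: sampling => [[V [VW best]]|/(@D_tracking_forced x)[forced best]].
    exact: (cumulative_tracks K0 (fun s => Wsimplex s x) (fun s => VW s x)
      (fun t => best t x) ve HL).
  have := direct_tracks (fun s => Wsimplex s x) forced best ve HL t b.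
  by move/le_trans; apply; rewrite lerD2r lerD2l ler_peMl// sqrtr_ge0.
have := sum_drawsR (A^~ x) t (R := R); rewrite (bigD1 a)//=.
have : \sum_(b | b != a) (draws (A^~ x) t b)%:R <= \sum_(b | b != a) (t%:R * v b)
    + K%:R * (t%:R * e + L%:R + K%:R * Num.sqrt t%:R + 1).
  apply: (@le_trans _ _ (\sum_(b | b != a) (t%:R * v b +
      (t%:R * e + L%:R + K%:R * Num.sqrt t%:R + 1)))).
    apply: ler_sum => b _; apply: le_trans (up b) _.
    by rewrite mulrDr !addrA.
  rewrite big_split/= lerD2l sumr_const -[leLHS]mulr_natl ler_wpM2r//.
    by rewrite !addr_ge0 ?mulr_ge0 ?sqrtr_ge0// ltW.
  by rewrite ler_nat -[leqRHS]card_ord max_card.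
have -> : \sum_(b | b != a) t%:R * v b = t%:R * (1 - v a).
  rewrite -mulr_sumr; congr (_ * _).
  by move: v1; rewrite (bigD1 a)//= => <-; rewrite addrAC subrr add0r.
have tL : (c1 + c2) * (L%:R + 1) <= t%:R.
  apply: (@le_trans _ _ ((Num.truncn (c1 + c2)).+1 * (L + 1))%:R); last by rewrite ler_nat.
  rewrite natrM addn1 -[L.+1%:R]natr1; apply: ler_wpM2r; first by rewrite addr_ge0.
  by have /andP[_ /ltW] := truncn_itv (addr_ge0 c10 c20).
have L1 : 1 <= L%:R + 1 :> R by rewrite lerDr.
have h1 : K%:R * (L%:R + 1) <= t%:R * (k / 4).
  have : c1 * (L%:R + 1) <= t%:R.
    by apply: le_trans tL; rewrite ler_wpM2r ?lerDl// addr_ge0.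
  move=> /(ler_wpM2r (_ : 0 <= k / 4)); rewrite divr_ge0 ?(ltW k0)// => /(_ isT).
  rewrite (_ : c1 * (L%:R + 1) * (k / 4) = K%:R * (L%:R + 1))//.
  by rewrite /c1; field; rewrite gt_eqF.
set s := Num.sqrt t%:R; have s0 : 0 <= s by exact: sqrtr_ge0.
have ss : s * s = t%:R by rewrite -expr2 sqr_sqrtr.
have h2 : K%:R * (K%:R * s) <= t%:R * (k / 4).
  have sc : 4 * K%:R ^+ 2 / k <= s.
    have q0 : 0 <= 4 * K%:R ^+ 2 / k by rewrite divr_ge0 ?mulr_ge0 ?sqr_ge0// ltW.
    rewrite -[leLHS](ger0_norm q0) -sqrtr_sqr /s ler_wsqrtr//.
    apply: le_trans tL; rewrite -/c2.
    have := ler_wpM2l c20 L1; rewrite mulr1 => /le_trans; apply.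
    by rewrite ler_wpM2r ?lerDr// addr_ge0.
  rewrite -ss -mulrA mulrCA mulrA -expr2 mulrC ler_wpM2l//.
  by move: sc; rewrite ler_pdivrMr//; lra.
have h3 : K%:R * (t%:R * e) = t%:R * (k / 2).
  by rewrite /e; field; rewrite gt_eqF.
move=> q1 q2; lra.
Qed.

End SamplingRules.
(** * An integrable bound on the last time of a large deviation *)
Section Deviations.
Context {R : realType} (E : expFamily R).
Local Notation Mean := (mean_dom E).
Local Notation b := (logpart E).

(** The exponential tilt by h gains h * e on a deviation e of the mean but only
    costs o(h), by differentiability of the log-partition function. *)
Lemma tilt_near m e : Mean m -> 0 < e ->
  let t := theta_of E m in
  \forall h \near (0 : R)^'+, [/\ param E (t + h), param E (t + - h),
    forall x, m + e <= x -> h * e / 2 <= h * x - (b (t + h) - b t) &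
    forall x, x <= m - e -> h * e / 2 <= - h * x - (b (t + - h) - b t)].
Proof.
move=> Dm e0 t; have Pt := theta_of_param Dm.
have [r r0 Hr] := param_ball Pt.
have e2 : 0 < e / 2 by rewrite divr_gt0.
have := logpart_derivable Pt => /cvgrPdist_le/(_ _ e2).
rewrite -/(derive b t 1) -derive1E db_theta_of// => /nbhs_ballP[r' /= r'0 Hr'].
near=> h.
have h0 : 0 < h by [].
have hr : h <= r by near: h; exact: nbhs_right_le.
have hr' : h < r' by near: h; exact: nbhs_right_lt.
have slope s : `|s| < r' -> s != 0 -> `|m - s^-1 * (b (t + s) - b t)| <= e / 2.
  move=> sr s0; have := Hr' s; rewrite /ball/= sub0r normrN => /(_ sr s0).
  suff -> : s^-1 * (b (t + s) - b t)
      = s^-1 *: ((b \o shift t) (s *: 1) - b t) by [].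
  by rewrite /GRing.scale/= mulr1 (addrC t s).
split.
- by apply: Hr; rewrite addrAC subrr add0r gtr0_norm.
- by apply: Hr; rewrite addrAC subrr add0r normrN gtr0_norm.
- move=> x xm; have := slope h; rewrite gtr0_norm// gt_eqF// => /(_ hr' isT).
  rewrite ler_norml => /andP[+ _]; set f := b (t + h) - b t => fh.
  have -> : f = h * (h^-1 * f) by rewrite mulrA divff ?mul1r// gt_eqF.
  rewrite -mulrBr -mulrA ler_pM2l//; lra.
- move=> x xm; have := slope (- h); rewrite normrN gtr0_norm// oppr_eq0 gt_eqF// => /(_ hr' isT).
  rewrite ler_norml => /andP[_ +]; set f := b (t + - h) - b t => fh.
  have -> : - h * x - f = h * ((- h)^-1 * f - x).
    by rewrite invrN; field; rewrite gt_eqF.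
  by rewrite -mulrA ler_pM2l//; lra.
Unshelve. all: by end_near. Qed.

End Deviations.

Section SubexponentialSeries.
Context {R : realType}.
Implicit Types (c : R).

Lemma expR_ge_pow6 : exists2 q : R, 0 < q & forall y, 0 <= y -> 1 + y ^+ 6 / q <= expR y.
Proof.
exists (6`!%:R); first by rewrite ltr0n fact_gt0.
by move=> y y0; exact: (expR_ge1Dxn 5 y0).
Qed.

(** The exponential beats any power of the square root, hence a cubic bound,
    which leaves a telescoping series. *)
Lemma subexp_term_le c : 0 < c -> exists2 C, 0 <= C & forall t : nat,
  t.+1%:R * expR (- (c * Num.sqrt t%:R)) <= C * (t.+1%:R^-1 - t.+2%:R^-1) :> R.
Proof.
move=> c0; have [q q0 expq] := expR_ge_pow6.
have c6 : 0 < c ^+ 6 by rewrite exprn_gt0.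
have qc0 : 0 < q / c ^+ 6 by rewrite divr_gt0.
exists (32 * (1 + q / c ^+ 6)); first by rewrite mulr_ge0// addr_ge0// ltW.
move=> t; set s := Num.sqrt _; have s0 : 0 <= s by exact: sqrtr_ge0.
have ss : s ^+ 2 = t%:R by rewrite sqr_sqrtr.
set x : R := t%:R; have x0 : 0 <= x by rewrite ler0n.
have exp6 : 1 + c ^+ 6 * x ^+ 3 / q <= expR (c * s).
  have := expq _ (mulr_ge0 (ltW c0) s0).
  by rewrite exprMn -[s ^+ 6]/(s ^+ (2 * 3)) exprM ss.
have -> : t.+1%:R^-1 - t.+2%:R^-1 = ((x + 1) * (x + 2))^-1.
  rewrite -[t.+2%:R]natr1 -[t.+1%:R]natr1 -/x; field.
  by rewrite !gt_eqF//; lra.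
rewrite -[t.+1%:R]natr1 -/x expRN ler_pdivrMr ?expR_gt0//.
rewrite mulrAC ler_pdivlMr ?mulr_gt0//; try lra.
apply: (@le_trans _ _ (32 * (1 + x ^+ 3))).
  rewrite !exprS expr0 mulr1.
  have : 0 <= x * x by rewrite mulr_ge0.
  have : 0 <= x * x * x by rewrite !mulr_ge0.
  have : 0 <= (x - 1) * (x - 1) * (x + 1) by rewrite mulr_ge0 -?expr2 ?sqr_ge0//; lra.
  by nra.
rewrite -mulrA ler_pM2l//; apply: le_trans (ler_wpM2l _ exp6); last first.
  by rewrite addr_ge0// ltW.
have x3 : 0 <= x ^+ 3 by rewrite exprn_ge0.
have -> : (1 + q / c ^+ 6) * (1 + c ^+ 6 * x ^+ 3 / q)
    = 1 + x ^+ 3 + (q / c ^+ 6 + c ^+ 6 * x ^+ 3 / q).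
  by field; rewrite !gt_eqF.
by rewrite lerDl addr_ge0// ?(ltW qc0)// divr_ge0 ?(ltW q0)// mulr_ge0// ltW.
Qed.

Lemma subexp_series_lty c : 0 < c ->
  (\sum_(0 <= t <oo) (t.+1%:R * expR (- (c * Num.sqrt (t%:R : R))))%:E < +oo)%E.
Proof.
move=> c0; have [C C0 HC] := subexp_term_le c0.
apply: (@le_lt_trans _ _ C%:E); last exact: ltry.
apply: lime_le.
  by apply: is_cvg_nneseries => n _ _; rewrite lee_fin mulr_ge0// expR_ge0.
apply: nearW => n; rewrite sumEFin lee_fin.
apply: (@le_trans _ _ (\sum_(0 <= t < n) C * (t.+1%:R^-1 - t.+2%:R^-1))).
  by apply: ler_sum => t _; exact: HC.
rewrite -mulr_sumr.
have -> : \sum_(0 <= t < n) (t.+1%:R^-1 - t.+2%:R^-1) = 1 - n.+1%:R^-1 :> R.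
  elim: n => [|n IH]; first by rewrite big_geq// invr1 subrr.
  by rewrite big_nat_recr//= IH addrA subrK.
by rewrite ler_piMr// gerBl invr_ge0.
Qed.

End SubexponentialSeries.

Section GoodTimes.
Context {R : realType} {K : nat} {d : measure_display} {T : measurableType d}.
Context (E : expFamily R) (P : probability T R).
Variables (A : nat -> T -> 'I_K) (X : nat -> T -> R) (F : nat -> set (set T)).
Variables (mu : 'I_K -> R) (hmodel : bandit_model E A X P F mu).
Hypothesis Dmu : forall a, mean_dom E (mu a).

Definition deviation_term (h c : R) (t : nat) (x : T) : R :=
  t.+1%:R * expR (- (c * Num.sqrt t%:R)) *
  \sum_a (lr E A X mu a h t x + lr E A X mu a (- h) t x).

(** At a time t with a bad empirical mean and at least of order sqrt t draws of
    each arm, one of the likelihood ratios is at least exp (c * sqrt t), so the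
    term of index t is at least t + 1. Thus the series bounds the last bad time;
    and it is integrable, since each ratio has mean 1. *)
Definition deviation_bound (h c : R) (x : T) : \bar R :=
  \sum_(0 <= t <oo) (deviation_term h c t x)%:E.

Lemma deviation_term_ge0 h c t x : 0 <= deviation_term h c t x.
Proof.
rewrite mulr_ge0 ?mulr_ge0 ?expR_ge0// sumr_ge0// => a _.
by rewrite addr_ge0// ltW// lr_gt0.
Qed.

Lemma deviation_term_measurable h c t :
  measurable_fun [set: T] (deviation_term h c t).
Proof.
apply: measurable_funM => //; apply: measurable_sum => a.
by apply: measurable_funD; apply: (lr_measurable hmodel).
Qed.

Lemma deviation_bound_ge0 h c x : (0 <= deviation_bound h c x)%E.
Proof. by apply: nneseries_ge0 => t _ _; rewrite lee_fin deviation_term_ge0. Qed.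

Lemma deviation_bound_measurable h c :
  measurable_fun [set: T] (deviation_bound h c).
Proof.
apply: ge0_emeasurable_sum => [t x _ _|t _]; first by rewrite lee_fin deviation_term_ge0.
by apply/measurable_EFinP; exact: deviation_term_measurable.
Qed.

Lemma deviation_bound_integral h c : 0 < c ->
  (forall a, param E (theta_of E (mu a) + h) /\ param E (theta_of E (mu a) + - h)) ->
  (\int[P]_x deviation_bound h c x < +oo)%E.
Proof.
move=> c0 Ph; rewrite /deviation_bound integral_nneseries//; last 2 first.
- by move=> t; apply/measurable_EFinP; exact: deviation_term_measurable.
- by move=> t x _; rewrite lee_fin deviation_term_ge0.
have termE t : (\int[P]_x (deviation_term h c t x)%:E
    = (2 * K%:R)%:E * (t.+1%:R * expR (- (c * Num.sqrt t%:R)))%:E)%E.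
  have lr0 a g x : (0 <= (lr E A X mu a g t x)%:E)%E by rewrite lee_fin ltW// lr_gt0.
  have mlr a g : measurable_fun [set: T] (fun x => (lr E A X mu a g t x)%:E).
    by apply/measurable_EFinP; exact: (lr_measurable hmodel).
  under eq_integral do rewrite /deviation_term EFinM.
  rewrite ge0_integralZl_EFin ?mulr_ge0 ?expR_ge0//; last 2 first.
  - by move=> x _; rewrite lee_fin sumr_ge0// => a _; rewrite addr_ge0// ltW// lr_gt0.
  - apply/measurable_EFinP; apply: measurable_sum => a.
    by apply: measurable_funD; apply: (lr_measurable hmodel).
  rewrite muleC; congr (_ * _)%E.
  under eq_integral do rewrite -sumEFin.
  rewrite ge0_integral_sum//; last 2 first.
  - by move=> a; apply/measurable_EFinP; apply: measurable_funD;
       apply: (lr_measurable hmodel).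
  - by move=> a x _; rewrite EFinD adde_ge0.
  rewrite (eq_bigr (fun=> 2%:E)).
    by rewrite sumEFin sumr_const card_ord -(mulr_natr 2 K).
  move=> a _; under eq_integral do rewrite EFinD.
  have [P1 P2] := Ph a.
  by rewrite ge0_integralD// !(lr_integral hmodel (Dmu a))// -EFinD.
rewrite (eq_eseriesr (fun t _ => termE t)) nneseriesZl//.
by rewrite lte_mul_pinfty// ?lee_fin ?mulr_ge0// subexp_series_lty.
Qed.

Lemma good_times h e x (N : nat -> 'I_K -> nat := draws (A^~ x)) t :
  0 < h -> 0 < e ->
  (forall a z, mu a + e <= z ->
    h * e / 2 <= h * z - (logpart E (theta_of E (mu a) + h) - logpart E (theta_of E (mu a)))) ->
  (forall a z, z <= mu a - e ->
    h * e / 2 <= - h * z - (logpart E (theta_of E (mu a) + - h) - logpart E (theta_of E (mu a)))) ->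
  (forall a, Num.sqrt t%:R / 8 <= (N t a)%:R :> R) ->
  (deviation_bound h (h * e / 16) x < t.+1%:R%:E)%E ->
  forall a, `|emp_mean (A^~ x) (X^~ x) t a - mu a| <= e.
Proof.
move=> h0 e0 up dn explore Glt a; set m := emp_mean _ _ _ _.
set c := h * e / 16 in Glt *.
have small g : g = h \/ g = - h -> lr E A X mu a g t x < expR (c * Num.sqrt t%:R).
  move=> gE; rewrite ltNge; apply/negP => big.
  suff : (t.+1%:R%:E <= deviation_bound h c x)%E by rewrite leNgt Glt.
  apply: (@le_trans _ _ (deviation_term h c t x)%:E); last first.
    have t0 k : xpredT k -> (0 <= (deviation_term h c k x)%:E)%E.
      by rewrite lee_fin deviation_term_ge0.
    rewrite /deviation_bound (@nneseriesD1 _ _ t xpredT)// leeDl//.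
    by apply: nneseries_ge0 => k _ _; exact: t0.
  rewrite lee_fin /deviation_term -mulrA ler_peMr// expRN mulrC ler_pdivlMr ?expR_gt0//.
  rewrite mul1r (le_trans big)// (bigD1 a)//=.
  have pos g' a' : 0 < lr E A X mu a' g' t x by exact: lr_gt0.
  apply: ler_wpDr; first by rewrite sumr_ge0// => a' _; rewrite addr_ge0// ltW.
  by case: gE => ->; [rewrite lerDl ltW|rewrite lerDr ltW].
have large g : g = h \/ g = - h ->
    h * e / 2 <= g * m - (logpart E (theta_of E (mu a) + g) - logpart E (theta_of E (mu a))) ->
    False.
  move=> /small + big; rewrite lrE ltr_expR ltNge => /negP; apply.
  have he : 0 <= h * e / 2 by rewrite divr_ge0// mulr_ge0 ?ltW.
  apply: (@le_trans _ _ ((draws (A^~ x) t a)%:R * (h * e / 2))); last by rewrite ler_wpM2l.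
  apply: le_trans (ler_wpM2r he (explore a)).
  by rewrite /c; lra.
rewrite ler_norml; apply/andP; split; rewrite leNgt; apply/negP => dev.
- by apply: (large (- h)); [right|apply: dn; lra].
- by apply: (large h); [left|apply: up; lra].
Qed.

End GoodTimes.
(** * The expected stopping time *)
Section Threshold.
Context {R : realType}.

(** The integral of a nonnegative function is a supremum over simple functions
    below it, so that a comparison requires no measurability; this applies to the
    stopping time. *)
Lemma le_integral_lower d (T : measurableType d) (P : {measure set T -> \bar R})
    (f g : T -> \bar R) :
  (forall x, 0 <= f x)%E -> (forall x, f x <= g x)%E ->
  (\int[P]_x f x <= \int[P]_x g x)%E.
Proof.
move=> f0 fg; have g0 x : (0 <= g x)%E by exact: le_trans (fg x).
rewrite !ge0_integralTE//; apply: le_ereal_sup => _ /= [h hf <-].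
by exists h => // x; exact: le_trans (fg x).
Qed.

Lemma ln_le_linear s : 0 < s -> exists2 C, 0 <= C & forall t : R, 0 < t -> ln t <= C + s * t.
Proof.
move=> s0; exists `|ln s^-1| => // t t0.
have st0 : 0 < s * t by rewrite mulr_gt0.
have -> : t = (s * t) * s^-1 by rewrite mulrAC divff ?mul1r// gt_eqF.
rewrite lnM ?posrE ?invr_gt0// addrC lerD ?ler_norm//.
rewrite [leRHS](_ : _ = s * t); last by field; rewrite gt_eqF.
exact/ltW/ln_sublinear.
Qed.

(** The logarithm of r t grows at most logarithmically, hence is below a line of
    any positive slope, up to a constant for the first times. *)
Lemma ln_threshold_le (r : nat -> R) (alpha s : R) : 0 < s -> 1 <= alpha ->
  (forall t, (1 <= t)%N -> 0 < r t) ->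
  r =O_\oo (fun t : nat => (t%:R : R) `^ alpha) ->
  exists2 C, 0 <= C & forall t delta, (1 <= t)%N -> 0 < delta ->
    ln (r t / delta) <= C + s * t%:R + ln delta^-1.
Proof.
move=> s0 al1 r0 /eqO_exP[k k0 [n _ Hn]].
have al0 : 0 < alpha by exact: lt_le_trans al1.
have sal : 0 < s / alpha by rewrite divr_gt0.
have [C C0 HC] := ln_le_linear sal.
pose D := \sum_(0 <= j < n) `|ln (r j)|.
have D0 : 0 <= D by exact: sumr_ge0.
have kC0 : 0 <= `|ln k| + alpha * C by rewrite addr_ge0// mulr_ge0// ltW.
exists (D + (`|ln k| + alpha * C)); first exact: addr_ge0.
move=> t delta t1 d0; rewrite lnM ?posrE ?r0 ?invr_gt0// lerD2r.
have t0 : 0 < (t%:R : R) by rewrite ltr0n.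
have st0 : 0 <= s * t%:R by rewrite mulr_ge0// ltW.
have [nt|tn] := leqP n t.
  have rt : r t <= k * t%:R `^ alpha.
    by have := Hn t nt; rewrite /= (ger0_norm (ltW (r0 _ t1))) (ger0_norm (powR_ge0 _ _)).
  have pw0 : 0 < t%:R `^ alpha by exact: powR_gt0.
  have : ln (r t) <= ln k + alpha * ln t%:R.
    rewrite -ln_powR -lnM ?posrE// ler_ln ?posrE ?r0// ?mulr_gt0//.
  move=> /le_trans; apply.
  have := ler_wpM2l (ltW al0) (HC _ t0); rewrite mulrDr.
  rewrite [alpha * (s / alpha * _)](_ : _ = s * t%:R); last by field; rewrite gt_eqF.
  have := ler_norm (ln k); lra.
have : ln (r t) <= D.
  apply: le_trans (ler_norm _) _.
  rewrite /D (bigD1_seq t)/= ?iota_uniq ?mem_index_iota//= lerDl; exact: sumr_ge0.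
lra.
Qed.

End Threshold.

Section Stopping.
Context {R : realType} {K : nat} {d : measure_display} {T : measurableType d}.
Context (E : expFamily R) (P : probability T R).
Variables (F : nat -> set (set T)) (A : nat -> T -> 'I_K) (X : nat -> T -> R).
Variables (mu : 'I_K -> R) (i : 'I_K).
Hypotheses (Dmu : forall a, mean_dom E (mu a))
  (mui : forall b, b != i -> mu b < mu i) (other_arm : exists b : 'I_K, b != i).
Hypothesis hmodel : bandit_model E A X P F mu.
Variable W : nat -> T -> 'I_K -> R.
Hypotheses (hW : plugin_weights E A X F W) (sampling : C_tracking A W \/ D_tracking A W).
Hypothesis rinfo_gt0 : 0 < rinfo E mu (wstar E mu).
Local Notation Tinv := (rinfo E mu (wstar E mu)).

Let nondegenerate : exists m m', [/\ mean_dom E m, mean_dom E m' & m <> m'].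
Proof.
have [b bi] := other_arm; exists (mu b), (mu i); split => //.
by apply/eqP; rewrite lt_eqF// mui.
Qed.

Let K0 : (0 < K)%N. Proof. exact: leq_ltn_trans (ltn_ord i). Qed.

Let Wsimplex t x : simplex (W t x). Proof. exact: (weights_simplex hW). Qed.

(** Close empirical means give close plug-in weights, hence draws in nearly optimal
    proportions after a time linear in L; the stopping statistic then grows at
    nearly the optimal rate. *)
Lemma chernoff_grows q : 0 < q -> q < Tinv ->
  exists2 eps, 0 < eps & exists C t1, forall x L, (t1 <= L)%N ->
    (forall t a, (L <= t)%N -> `|emp_mean (A^~ x) (X^~ x) t a - mu a| <= eps) ->
    forall t, (C * (L + 1) <= t)%N ->
      ((t%:R * q)%:E <= chernoff E (A^~ x) (X^~ x) t)%E.
Proof.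
move=> q0 qT; set v := wstar E mu.
have sv : simplex v := wstar_simplex nondegenerate Dmu mui other_arm.
have [v0 v1] := sv.
have [t0 Ht0] := exploration K0 sampling.
have vpos a : 0 < v a.
  have pos b : b != i -> 0 < v i /\ 0 < v b.
    move=> bi; apply: (pair_info_gt0_weights nondegenerate Dmu mui sv bi).
    exact: lt_le_trans rinfo_gt0 (rinfo_le nondegenerate Dmu mui other_arm sv bi).
  have [->|ai] := eqVneq a i; last by have [] := pos _ ai.
  by have [b bi] := other_arm; have [] := pos _ bi.
pose Tn := Tinv; have Tn0 : 0 < Tn by [].
have qTn : q < Tn by [].
(* a proportion kap is lost on the draws and on the information each, and
   (1 - kap)^2 * Tn >= q *)
pose kap := (Tn - q) / (2 * Tn).
have kap0 : 0 < kap by rewrite divr_gt0 ?subr_gt0 ?mulr_gt0.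
have kapT : kap * Tn = (Tn - q) / 2 by rewrite /kap; field; rewrite gt_eqF.
have kap1 : kap < 1 by rewrite ltr_pdivrMr ?mulr_gt0//; lra.
have e10 : 0 < kap * Tn by rewrite mulr_gt0.
have [k k0 kv] : exists2 k, 0 < k & forall a, k <= kap * v a.
  have H : \forall k \near (0 : R)^'+, forall a, k <= kap * v a.
    apply: filter_forall => a; apply: nbhs_right_le; exact: mulr_gt0.
  near (0 : R)^'+ => k; exists k => //.
  by near: k.
have [e e0 [C HC]] := tracks K0 Wsimplex sampling sv k0.
have [eta1 eta10 Heta1] := wstar_continuous nondegenerate Dmu mui other_arm rinfo_gt0 e0.
have [eta2 eta20 Heta2] := pair_info_perturb_means nondegenerate Dmu mui e10.
exists (Num.min eta1 eta2); first by rewrite lt_min eta10.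
exists C.+1, (t0 + 1)%N => x L t1L good t Ct.
have good1 s a : (L <= s)%N -> `|emp_mean (A^~ x) (X^~ x) s a - mu a| <= eta1.
  by move=> Ls; apply: le_trans (good s a Ls) _; rewrite ge_min lexx.
have good2 s a : (L <= s)%N -> `|emp_mean (A^~ x) (X^~ x) s a - mu a| <= eta2.
  by move=> Ls; apply: le_trans (good s a Ls) _; rewrite ge_min lexx orbT.
have Wv s a : (L <= s)%N -> W s x a <= v a + e.
  move=> Ls; have [bs ws] := Heta1 _ (fun a => good1 s a Ls).
  rewrite (weights_wstar hW) => [|b|//]; last first.
    have t0s : (t0 <= s)%N by apply: leq_trans Ls; apply: leq_trans t1L; rewrite leq_addr.
    have s0 : (0 < s)%N by apply: leq_trans Ls; apply: leq_trans t1L; rewrite addn1.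
    rewrite -(ltr_nat R); apply: lt_le_trans (Ht0 x s b t0s).
    by rewrite divr_gt0// sqrtr_gt0 ltr0n.
  by have := ws a; rewrite ler_norml => /andP[_]; rewrite lerBlDl addrC.
have Ct' : (C * (L + 1) <= t)%N by apply: leq_trans Ct; rewrite leq_mul2r leqnSn orbT.
have Lt : (L <= t)%N by apply: leq_trans Ct; rewrite mulSn -addnA leq_addr.
have Nv a : t%:R * (1 - kap) * v a <= (draws (A^~ x) t a)%:R.
  apply: le_trans (HC x L Wv t a Ct'); rewrite -mulrA ler_wpM2l//.
  by rewrite mulrBl mul1r lerB.
have [Dm mi Hm] := Heta2 _ (fun a => good2 t a Lt).
apply: (chernoff_ge nondegenerate Dm mi) => b bi.
have p0 : 0 <= 1 - kap by rewrite subr_ge0 ltW.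
have tp0 : 0 <= t%:R * (1 - kap) by rewrite mulr_ge0.
apply: le_trans (pair_info_scale nondegenerate Dm (ltW (mi _ bi)) (v0 i) (v0 b) tp0
  (Nv i) (Nv b)).
rewrite -mulrA ler_wpM2l//.
have := Hm v b v0 bi; rewrite ler_norml => /andP[hm _].
have hT : Tn <= pair_info E mu v i b := rinfo_le nondegenerate Dmu mui other_arm sv bi.
have vib : (v i + v b) * (kap * Tn) <= kap * Tn.
  rewrite ler_piMl ?(ltW e10)// -v1 (bigD1 i)//= (bigD1 b)//= addrA lerDl.
  exact: sumr_ge0.
have combine (x1 x2 x3 : R) : - x3 <= x1 - x2 -> x3 <= kap * Tn -> Tn <= x2 ->
    Tn - kap * Tn <= x1 by move=> *; lra.
have := combine _ _ _ hm vib hT => /(ler_wpM2l p0); apply: le_trans.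
rewrite mulrBl mul1r mulrBr kapT.
have : 0 <= kap * ((Tn - q) / 2) by rewrite mulr_ge0 ?(ltW kap0)// divr_ge0// subr_ge0 ltW.
move: (Tn) kapT => z zE; lra.
Unshelve. all: by end_near. Qed.

(** On each trajectory the rule stops no later than the sum, up to a constant, of a
    multiple of the last bad time, which has finite mean independent of delta, and
    of the time (C3 + ln delta^-1) / q, after which a line of slope q1 > q is above
    the threshold. *)
Lemma expected_stopping_time (alpha : R) (r : nat -> R) q :
  1 <= alpha -> (forall t, (1 <= t)%N -> 0 < r t) ->
  r =O_\oo (fun t : nat => (t%:R : R) `^ alpha) ->
  0 < q -> q < Tinv -> exists C, forall delta, 0 < delta -> delta < 1 ->
  (\int[P]_x stopping_time E (fun t => ln (r t / delta))
                  (fun t => A t x) (fun t => X t x)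
   <= (ln delta^-1 / q + C)%:E)%E.
Proof.
move=> al1 r0 rO q0 qT.
pose Tn := Tinv; have qTn : q < Tn by [].
pose q1 := (q + Tn) / 2; have qq1 : q < q1 by rewrite /q1; lra.
have q1T : q1 < Tinv by rewrite -/Tn /q1; lra.
have q10 : 0 < q1 by exact: lt_trans qq1.
have [eps eps0 [C [t1 Hgrow]]] := chernoff_grows q10 q1T.
have s0 : 0 < q1 - q by rewrite subr_gt0.
have [C3 C30 HC3] := ln_threshold_le s0 al1 r0 rO.
have [t0 Ht0] := exploration K0 sampling.
have [h h0 Hh] : exists2 h, 0 < h & forall a, let t := theta_of E (mu a) in
    [/\ param E (t + h), param E (t + - h),
    forall x, mu a + eps <= x -> h * eps / 2 <= h * x - (logpart E (t + h) - logpart E t) &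
    forall x, x <= mu a - eps -> h * eps / 2 <= - h * x - (logpart E (t + - h) - logpart E t)].
  have /filter_forall H := fun a => tilt_near (Dmu a) eps0.
  near (0 : R)^'+ => h; exists h => //.
  by near: h; exact: H.
pose c := h * eps / 16; have c0 : 0 < c by rewrite divr_gt0// mulr_gt0.
pose G := deviation_bound E A X mu h c.
have G0 x : (0 <= G x)%E by exact: deviation_bound_ge0.
have mG : measurable_fun [set: T] G by exact: (deviation_bound_measurable hmodel).
have GI : (\int[P]_x G x < +oo)%E.
  apply: (deviation_bound_integral hmodel Dmu) => // a.
  by have [] := Hh a.
pose tt := (t0 + t1)%N.
pose D : R := C.+1%:R * (tt%:R + 2) + 1.
have D0 : 0 <= D by rewrite /D addr_ge0// mulr_ge0// addr_ge0.
exists (C3 / q + D + C.+1%:R * fine (\int[P]_x G x)) => delta d0 d1.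
set l := ln delta^-1; have l0 : 0 <= l by rewrite ln_ge0// invf_ge1// ltW.
(* the slope q1 - q is left to absorb the growth of the threshold in t *)
pose T0 := (C3 + l) / q.
have T00 : 0 <= T0 by rewrite divr_ge0 ?(ltW q0)// addr_ge0.
apply: (@le_trans _ _ (\int[P]_x ((T0 + D)%:E + C.+1%:R%:E * G x))%E); last first.
  rewrite ge0_integralD//; last 3 first.
  - by move=> x _; rewrite lee_fin addr_ge0.
  - by move=> x _; rewrite mule_ge0.
  - exact: measurable_funeM.
  rewrite integral_cst// ge0_integralZl_EFin//.
  rewrite (_ : (_ * P _ = (T0 + D)%:E)%E); last first.
    by rewrite -[RHS]mule1; congr (_ * _)%E; exact: probability_setT.
  rewrite -[in leLHS](fineK (x := \int[P]_x G x)%E) ?ge0_fin_numE ?integral_ge0//.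
  rewrite -EFinM -EFinD lee_fin /T0 mulrDl; lra.
apply: le_integral_lower => x.
  by apply: le_ereal_inf_tmp => _ [t _ <-]; rewrite lee_fin.
have [Goo|] := eqVneq (G x) +oo%E.
  by rewrite Goo gt0_muley ?lte_fin// addey// leey.
rewrite -ltey => Gfin.
have Gnum : G x \is a fin_num by rewrite ge0_fin_numE.
pose g := fine (G x); have GE : G x = g%:E by rewrite fineK.
have g0 : 0 <= g by exact: fine_ge0.
pose L := (tt + (Num.truncn g).+1)%N.
have /andP[gl gr] := truncn_itv g0.
have good t a : (L <= t)%N -> `|emp_mean (A^~ x) (X^~ x) t a - mu a| <= eps.
  move=> Lt; have t0t : (t0 <= t)%N.
    by apply: leq_trans Lt; rewrite /L /tt -addnA leq_addr.
  apply: (good_times (E := E) (A := A) (X := X) (h := h) (x := x) (t := t)) => //.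
  - by move=> a' z; have [_ _ + _] := Hh a'; apply.
  - by move=> a' z; have [_ _ _ +] := Hh a'; apply.
  - by move=> a'; exact: Ht0.
  - rewrite -/c -/(G x) GE lte_fin; apply: (lt_le_trans gr); rewrite ler_nat.
    by rewrite ltnS (leq_trans _ Lt)// /L addnS ltnW// ltnS leq_addl.
have t1L : (t1 <= L)%N by rewrite /L /tt addnAC leq_addl.
pose t := (C * (L + 1) + (Num.truncn T0).+1)%N.
have Ct : (C * (L + 1) <= t)%N by rewrite leq_addr.
have /andP[Tl Tr] := truncn_itv T00.
have tT : T0 < t%:R by apply: (lt_le_trans Tr); rewrite ler_nat leq_addl.
have tpos : (1 <= t)%N by rewrite /t addnS.
apply: (@le_trans _ _ (t%:R)%:E).
  apply: ereal_inf_lbound; exists t => //; split => //.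
  apply: lt_le_trans (Hgrow x L t1L good t Ct); rewrite lte_fin.
  apply: (le_lt_trans (HC3 t delta tpos d0)); rewrite -/l.
  have : C3 + l < t%:R * q by rewrite -ltr_pdivrMr.
  by rewrite mulrBl; lra.
rewrite GE -EFinM -EFinD lee_fin /t natrD natrM -[(Num.truncn T0).+1%:R]natr1.
have LE : (L + 1)%:R <= tt%:R + 2 + g :> R.
  by rewrite /L !natrD -[(Num.truncn g).+1%:R]natr1; lra.
have : C%:R * (L + 1)%:R <= C.+1%:R * (tt%:R + 2 + g).
  by apply: ler_pM => //; rewrite ler_nat.
by rewrite /D; lra.
Unshelve. all: by end_near. Qed.

End Stopping.

Theorem theorem14 (R : realType) (K : nat) (hK : (2 <= K)%N)
    (E : expFamily R) (mu : 'I_K -> R) (hmu : bandits E mu)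
    (d : measure_display) (T : measurableType d) (P : probability T R)
    (F : nat -> set (set T)) (A : nat -> T -> 'I_K) (X : nat -> T -> R)
    (hmodel : bandit_model E A X P F mu)
    (W : nat -> T -> 'I_K -> R) (hW : plugin_weights E A X F W)
    (hsampling : C_tracking A W \/ D_tracking A W)
    (alpha : R) (halpha : 1 <= alpha <= expR 1 / 2)
    (r : nat -> R) (hr : forall t, (1 <= t)%N -> 0 < r t)
    (hrO : r =O_\oo (fun t : nat => (t%:R : R) `^ alpha)) :
  (limf_esup (fun delta : R =>
     (\int[P]_x stopping_time E (fun t => ln (r t / delta))
                  (fun t => A t x) (fun t => X t x))
     / (ln delta^-1)%:E) 0^'+
   <= alpha%:E * Tstar E mu)%E.
Proof.
have [Dmu bmu] := hmu; have [i _ mui] := best_armP bmu.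
have other_arm : exists b : 'I_K, b != i.
  pose u := Ordinal (leq_trans (isT : (0 < 2)%N) hK); pose v := Ordinal hK.
  by have [iu|iu] := eqVneq i u; [exists v; rewrite iu|exists u; rewrite eq_sym].
have nondegenerate : exists m m', [/\ mean_dom E m, mean_dom E m' & m <> m'].
  have [b bi] := other_arm; exists (mu b), (mu i); split => //.
  by apply/eqP; rewrite lt_eqF// mui.
have /andP[al1 _] := halpha.
have sw := wstar_simplex nondegenerate Dmu mui other_arm.
have T0 := rinfo_ge0 nondegenerate Dmu mui other_arm sw.
rewrite /Tstar (Tstar_invE nondegenerate Dmu mui other_arm) inver.
case: eqVneq => [_|Tn0].
  by rewrite gt0_muley ?leey// lte_fin (lt_le_trans ltr01).
have Tpos : 0 < rinfo E mu (wstar E mu) by rewrite lt_neqAle eq_sym Tn0.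
set Tn := rinfo E mu (wstar E mu) in T0 Tn0 Tpos *.
apply: (@le_trans _ _ (Tn^-1)%:E); last first.
  by rewrite -EFinM lee_fin ler_peMl// invr_ge0.
apply/lee_addgt0Pr => e e0; rewrite -EFinD; set y := Tn^-1 + e.
have yT : Tn^-1 < y by rewrite ltrDl.
have y0 : 0 < y by apply: lt_trans yT; rewrite invr_gt0.
have yT' : y^-1 < Tn by rewrite -[ltRHS]invrK ltf_pV2 ?posrE ?invr_gt0.
pose q := (y^-1 + Tn) / 2.
have y'0 : 0 < y^-1 by rewrite invr_gt0.
have q0 : 0 < q by rewrite divr_gt0// addr_gt0.
have qT : q < Tn by rewrite /q; lra.
have qy : q^-1 < y.
  by rewrite -[ltRHS]invrK ltf_pV2 ?posrE// /q; lra.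
have [C HC] := expected_stopping_time Dmu mui other_arm hmodel hW hsampling Tpos
  al1 hr hrO q0 qT.
pose l0 := `|C| / (y - q^-1) + 1.
have l00 : 0 < l0 by rewrite ltr_pwDr// divr_ge0// subr_ge0 ltW.
pose V := [set delta : R | 0 < delta /\ delta < expR (- l0)].
have nV : \forall delta \near (0 : R)^'+, V delta.
  near=> delta; split => //.
  by near: delta; apply: nbhs_right_lt; exact: expR_gt0.
rewrite /limf_esup; apply: le_trans (ereal_inf_lbound _) _; first by exists V.
apply: ge_ereal_sup => _ [delta [d0 d1] <-].
have d1' : delta < 1 by apply: (lt_trans d1); rewrite expR_lt1 oppr_lt0.
have ll0 : l0 < ln delta^-1.
  by rewrite -ltr_expR lnK ?posrE ?invr_gt0// -[ltLHS]invrK -expRN ltf_pV2 ?posrE ?expR_gt0.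
set l := ln delta^-1 in ll0 *; have lpos : 0 < l by exact: lt_trans ll0.
have := HC delta d0 d1'; rewrite -/l => Hint.
rewrite inver gt_eqF//; have l'0 : 0 <= l^-1 by rewrite invr_ge0 ltW.
apply: (@le_trans _ _ ((l / q + C)%:E * l^-1%:E)%E).
  by rewrite lee_wpmul2r// lee_fin.
rewrite -EFinM lee_fin ler_pdivrMr//.
have : `|C| < (y - q^-1) * l.
  rewrite mulrC -ltr_pdivrMr ?subr_gt0//; apply: le_lt_trans ll0.
  by rewrite /l0 lerDl.
by have := ler_norm C; rewrite mulrBl [l / q]mulrC; lra.
Unshelve. all: by end_near. Qed.
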